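(* Let $\mathcal{C}_{\mathbb{A}_n}$ be the cluster category of the linearly oriented quiver $\mathbb{A}_n:n\to n-1\to\cdots\to1$, write $(i,j)=\tau^{-i}P_j$ for $j\ge1$, $i\ge0$, $i+j\le n$, and $(i,0)=0$, and put $x_0=x_{n+1}=1$. Then: (i) For $1\le j\le n$, $$x_jX_{(j-1,1)}=x_{j-1}y_j+x_{j+1}z_j.$$ (ii) For $j\ge0$, $\alpha\ge1$ and $j+\alpha\le\beta\le n$, $$X_{(j,\beta-j)}\,x_{j+\alpha}=X_{(j+\alpha,\beta-j-\alpha)}\,x_j\,y^{\dim(j,\alpha)}+X_{(j,\alpha-1)}\,x_{\beta+1}\,z^{\dim(j+\alpha-1,\beta-j-\alpha+1)}.$$ (iii) For $1\le j\le n$, with a $j\times j$ tridiagonal determinant on the right, $$z_1\cdots z_{j-1}x_j=\left|\begin{array}{ccccc}x_1&y_1&0&\cdots&0\\ 1&X_{(0,1)}&y_2&\cdots&0\\ 0&z_1&\ddots&&\vdots\\ \vdots&&&&y_{j-1}\\ 0&\cdots&0&z_{j-2}&X_{(j-2,1)}\end{array}\right|$$ (diagonal entries $x_1,X_{(0,1)},\dots,X_{(j-2,1)}$, superdiagonal entries $y_1,\dots,y_{j-1}$, subdiagonal entries $1,z_1,\dots,z_{j-2}$).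
   Context: Let $k$ be an algebraically closed field. $\mathcal{C}_Q$ is the cluster category of $Q$, the orbit category of $\mathcal{D}^b(\mathrm{mod}\,kQ)$ by $\tau^{-1}[1]$, with Auslander–Reiten translation $\tau$. $P_j$ is the indecomposable projective module at vertex $j$; for $\mathbb{A}_n$ as in the claim, $P_1$ is simple, and for $j\ge1$, $i\ge0$, $i+j\le n$ the object $(i,j)$ is the indecomposable module with support $\{i+1,\dots,i+j\}$; in particular $(i,1)=S_{i+1}$. $\dim$ denotes the dimension vector. The cluster character with coefficients $X_?:\mathrm{obj}\,\mathcal{C}_Q\to\mathbb{Q}(x_1,\dots,x_n,y_1,\dots,y_n,z_1,\dots,z_n)$ is the map with $X_{M\oplus N}=X_MX_N$ (so $X_0=1$), $X_{P_i[1]}=x_i$, and, for an indecomposable $kQ$-module $V$ with dimension vector $d=(d_1,\dots,d_n)$, $$X_V=\sum_{0\le e\le d}\chi(\mathrm{Gr}_e(V))\prod_{r=1}^n x_r^{-\langle e,\alpha_r\rangle-\langle\alpha_r,d-e\rangle}\,y_r^{e_r}z_r^{d_r-e_r},$$ where $\mathrm{Gr}_e(V)$ is the Grassmannian of submodules of $V$ of dimension vector $e$, $\chi$ the Euler characteristic, $\alpha_r$ the dimension vector of the simple $S_r$, and $\langle\ ,\ \rangle$ the Euler form. For an integer vector $v$, $y^v=\prod_ry_r^{v_r}$ and $z^v=\prod_rz_r^{v_r}$. *)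

(* Defs.v *)
From HB Require Import structures.
From mathcomp Require Import all_boot all_order all_algebra.
From mathcomp Require Import mpoly.

Set Implicit Arguments.
Unset Strict Implicit.
Unset Printing Implicit Defensive.

Import Order.TTheory GRing.Theory Num.Theory.
Local Open Scope ring_scope.

(* Varieties are presented in the style of Serre: a set of points, its open
   subsets, and, for every open subset O, the functions that are regular on O
   (only their values on O matter).  No axiom is imposed here: the sheaf
   conditions are part of is_variety. *)

Record kspace (k : closedFieldType) := KSpace {
  kpt :> Type;
  kopen : (kpt -> Prop) -> Prop;
  kreg : (kpt -> Prop) -> (kpt -> k) -> Prop }.

Section Spaces.
Variable k : closedFieldType.
Implicit Types X Y : kspace k.

Definition kiso X Y : Prop :=
  exists (f : X -> Y) (g : Y -> X),
    [/\ cancel f g, cancel g f,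
        forall O, kopen O <-> kopen (fun x => O (f x))
      & forall O h, kopen O ->
          (kreg O h <-> kreg (fun x => O (f x)) (fun x => h (f x)))].

Definition peval (T : Type) (I : finType) (c : I -> T -> k) (x : T)
    (p : {mpoly k[#|I|]}) : k :=
  p.@[fun i => c (enum_val i) x].

(* T is seen through the coordinates c as a subset of affine space; the
   structure is the one induced from affine space, which is the right one as
   soon as the image is locally closed. *)
Definition zariski_space (T : Type) (I : finType) (c : I -> T -> k) : kspace k :=
  KSpace (kpt := T)
    (fun O => exists S : {mpoly k[#|I|]} -> Prop,
       forall x, O x <-> exists2 p, S p & peval c x p != 0)
    (fun O f => forall x, O x ->
       exists p q : {mpoly k[#|I|]}, peval c x q != 0 /\
         forall y, O y -> peval c y q != 0 -> f y = peval c y p / peval c y q).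

Definition sub_space X (Z : X -> Prop) : kspace k :=
  KSpace (kpt := {x : X | Z x})
    (fun O => exists2 O' : X -> Prop, kopen O' &
       forall x, O x <-> O' (sval x))
    (fun O f => forall x, O x ->
       exists (O' : X -> Prop) (g : X -> k),
         [/\ kopen O', O' (sval x), kreg O' g
           & forall y, O y -> O' (sval y) -> f y = g (sval y)]).

Definition quotient_space X (T : Type) (p : X -> T) : kspace k :=
  KSpace (kpt := T)
    (fun O => kopen (fun x => O (p x)))
    (fun O f => kreg (fun x => O (p x)) (fun x => f (p x))).

Definition zeros m (S : {mpoly k[m]} -> Prop) : Type :=
  {x : 'rV[k]_m | forall p, S p -> p.@[x 0] = 0}.

Definition zcoord m (S : {mpoly k[m]} -> Prop) (i : 'I_m) (x : zeros S) : k :=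
  sval x 0 i.

Definition affine_variety m (S : {mpoly k[m]} -> Prop) : kspace k :=
  zariski_space (@zcoord m S).

Definition affine_product m1 (S1 : {mpoly k[m1]} -> Prop)
    m2 (S2 : {mpoly k[m2]} -> Prop) : kspace k :=
  @zariski_space (zeros S1 * zeros S2)%type ('I_m1 + 'I_m2)%type
    (fun i x => match i with
                | inl i1 => zcoord i1 x.1
                | inr i2 => zcoord i2 x.2
                end).

Definition affine_space m : kspace k :=
  affine_variety (fun _ : {mpoly k[m]} => False).

Definition is_affine X : Prop :=
  exists m (S : {mpoly k[m]} -> Prop), kiso X (affine_variety S).

(* X is glued from finitely many affine open pieces U i; the last two clauses
   say that open subsets and regular functions are detected on the pieces. *)
Definition is_variety X : Prop :=
  exists r (U : 'I_r -> X -> Prop),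
    [/\ forall x, exists i, U i x,
        forall i, kopen (U i) /\ is_affine (sub_space (U i)),
        forall O : X -> Prop,
          kopen O <-> forall i, @kopen k (sub_space (U i)) (fun x => O (sval x))
      & forall (O : X -> Prop) f, kopen O ->
          (kreg O f <->
           forall i, @kreg k (sub_space (U i)) (fun x => O (sval x))
                       (fun x => f (sval x)))].

(* The Euler characteristic is axiomatised as an invariant of varieties.
   These properties are satisfied by the Euler characteristic with compact
   support of l-adic cohomology (l invertible in k), and, when k is the field
   of complex numbers, of singular cohomology; for the projective varieties
   to which it is applied below, this is the Euler characteristic. *)
Record euler_characteristic (chi : kspace k -> int) : Prop := {
  chi_iso : forall X Y, is_variety X -> kiso X Y -> chi X = chi Y;
  chi_additive : forall X (Z : X -> Prop), is_variety X ->
    kopen (fun x => ~ Z x) ->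
    chi X = chi (sub_space Z) + chi (sub_space (fun x => ~ Z x));
  chi_product : forall m1 (S1 : {mpoly k[m1]} -> Prop)
      m2 (S2 : {mpoly k[m2]} -> Prop),
    chi (affine_product S1 S2) = chi (affine_variety S1) * chi (affine_variety S2);
  chi_affine_space : forall m, chi (affine_space m) = 1 }.

End Spaces.

(* The ordinal i : 'I_n stands for the vertex numbered i + 1. *)
Record quiver (n : nat) := Quiver {
  arrow : finType;
  src : arrow -> 'I_n;
  tgt : arrow -> 'I_n }.

Definition linear_quiver (n : nat) : quiver n :=
  @Quiver n {p : 'I_n * 'I_n | (p.1 : nat) == p.2.+1}
    (fun a => (val a).1) (fun a => (val a).2).

Definition euler_form n (Q : quiver n) (d e : 'I_n -> int) : int :=
  \sum_i d i * e i - \sum_(a : arrow Q) d (src a) * e (tgt a).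

Section Representations.
Variables (k : closedFieldType) (n : nat) (Q : quiver n).

(* The space at the vertex i is 'rV_(rdim i); matrices act on the right. *)
Record rep := Rep {
  rdim : 'I_n -> nat;
  rmap : forall a : arrow Q, 'M[k]_(rdim (src a), rdim (tgt a)) }.

Definition hom_family (V W : rep) := forall i : 'I_n, 'M[k]_(rdim V i, rdim W i).

Definition is_hom (V W : rep) (f : hom_family V W) : Prop :=
  forall a : arrow Q, rmap V a *m f (tgt a) = f (src a) *m rmap W a.

Definition rep_iso (V W : rep) : Prop :=
  exists (f : hom_family V W) (g : hom_family W V),
    [/\ is_hom f, is_hom g, forall i, f i *m g i = 1%:M
      & forall i, g i *m f i = 1%:M].

Definition rep0 : rep := @Rep (fun _ => 0%N) (fun a => 0).

Definition rep_sum (V W : rep) : rep :=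
  @Rep (fun i => (rdim V i + rdim W i)%N)
       (fun a => block_mx (rmap V a) 0 0 (rmap W a)).

Definition rep_simple (j : 'I_n) : rep :=
  @Rep (fun i => nat_of_bool (i == j)) (fun a => 0).

Definition is_zero (V : rep) : Prop := forall i, rdim V i = 0%N.

Definition indecomposable (V : rep) : Prop :=
  ~ is_zero V /\
  forall V1 V2, rep_iso V (rep_sum V1 V2) -> is_zero V1 \/ is_zero V2.

Definition mono (V W : rep) (f : hom_family V W) : Prop :=
  is_hom f /\ forall i, row_free (f i).

Definition epi (V W : rep) (f : hom_family V W) : Prop :=
  is_hom f /\ forall i, row_full (f i).

Definition factors_through_source (V W Y : rep)
    (f : hom_family V W) (h : hom_family V Y) : Prop :=
  exists2 u : hom_family W Y, is_hom u & forall i, h i = f i *m u i.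

Definition factors_through_target (V W Y : rep)
    (g : hom_family V W) (h : hom_family Y W) : Prop :=
  exists2 u : hom_family Y V, is_hom u & forall i, h i = u i *m g i.

Definition hom_id (V : rep) : hom_family V V := fun i => 1%:M.

Definition split_mono (V W : rep) (f : hom_family V W) : Prop :=
  factors_through_source f (@hom_id V).

Definition split_epi (V W : rep) (g : hom_family V W) : Prop :=
  factors_through_target g (@hom_id W).

Definition projective_at (j : 'I_n) (P : rep) : Prop :=
  [/\ indecomposable P,
      forall (V W : rep) (g : hom_family V W) (h : hom_family P W),
        epi g -> is_hom h -> factors_through_target g h
    & exists2 f : hom_family P (rep_simple j), is_hom f & exists i, f i != 0].

Definition injective_at (j : 'I_n) (I : rep) : Prop :=
  [/\ indecomposable I,
      forall (V W : rep) (f : hom_family V W) (h : hom_family V I),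
        mono f -> is_hom h -> factors_through_source f h
    & exists2 f : hom_family (rep_simple j) I, is_hom f & exists i, f i != 0].

Definition short_exact (M E N : rep) (f : hom_family M E) (g : hom_family E N)
  : Prop :=
  [/\ mono f, epi g & forall i, (f i :=: kermx (g i))%MS].

Definition left_almost_split (M E : rep) (f : hom_family M E) : Prop :=
  [/\ is_hom f, ~ split_mono f
    & forall (Y : rep) (h : hom_family M Y),
        is_hom h -> ~ split_mono h -> factors_through_source f h].

Definition right_almost_split (E N : rep) (g : hom_family E N) : Prop :=
  [/\ is_hom g, ~ split_epi g
    & forall (Y : rep) (h : hom_family Y N),
        is_hom h -> ~ split_epi h -> factors_through_target g h].

Definition almost_split_sequence (M N : rep) : Prop :=
  exists (E : rep) (f : hom_family M E) (g : hom_family E N),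
    [/\ short_exact f g, left_almost_split f & right_almost_split g].

(* A subspace of 'rV_d is encoded by its canonical square matrix <<U>>. *)
Definition is_subrep (V : rep) (U : {dffun forall i, 'M[k]_(rdim V i)}) : bool :=
  [forall i, <<U i>>%MS == U i] &&
  [forall a : arrow Q, (U (src a) *m rmap V a <= U (tgt a))%MS].

Definition gr_point (V : rep) (e : 'I_n -> nat) : Type :=
  {U : {dffun forall i, 'M[k]_(rdim V i)} |
    is_subrep U && [forall i, \rank (U i) == e i]}.

Definition row_spaces (V : rep) (e : 'I_n -> nat)
    (A : {dffun forall i, 'M[k]_(e i, rdim V i)})
  : {dffun forall i, 'M[k]_(rdim V i)} :=
  [ffun i => <<A i>>%MS].

(* Families of bases (as rows of matrices) of the members of a subrepresentation
   of dimension vector e. *)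
Definition gr_frame (V : rep) (e : 'I_n -> nat) : Type :=
  {A : {dffun forall i, 'M[k]_(e i, rdim V i)} |
    is_subrep (row_spaces A) && [forall i, row_free (A i)]}.

Lemma gr_of_frame_proof (V : rep) (e : 'I_n -> nat) (A : gr_frame V e) :
  is_subrep (row_spaces (val A)) &&
  [forall i, \rank (row_spaces (val A) i) == e i].
Proof.
case: A => A /= /andP[-> /forallP freeA] /=.
by apply/forallP=> i; rewrite ffunE genmxE; exact: freeA.
Qed.

Definition gr_of_frame (V : rep) (e : 'I_n -> nat) (A : gr_frame V e)
  : gr_point V e := exist _ (row_spaces (val A)) (gr_of_frame_proof A).

Definition gr_frame_coord (V : rep) (e : 'I_n -> nat)
    (x : {i : 'I_n & ('I_(e i) * 'I_(rdim V i))%type}) (A : gr_frame V e) : k :=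
  val A (tag x) (tagged x).1 (tagged x).2.

(* Gr_e(V) is the quotient of the variety of frames by the free action of the
   product of the general linear groups GL_(e i). *)
Definition quiver_grassmannian (V : rep) (e : 'I_n -> nat) : kspace k :=
  @quotient_space k (zariski_space (@gr_frame_coord V e)) (gr_point V e)
    (@gr_of_frame V e).

(* For Q acyclic, every object of the orbit category of D^b(mod kQ) by
   tau^-1[1] is isomorphic to M (+) (+)_i P_i[1]^(m i) for a representation M,
   unique up to isomorphism, and a unique multiplicity vector m. *)
Record cobj := CObj { cmod : rep; cshift : 'I_n -> nat }.

Definition ciso (A B : cobj) : Prop :=
  rep_iso (cmod A) (cmod B) /\ cshift A =1 cshift B.

Definition cmodule (V : rep) : cobj := CObj V (fun _ => 0%N).

Definition czero : cobj := cmodule rep0.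

Definition cshiftP (j : 'I_n) : cobj := CObj rep0 (fun i => nat_of_bool (i == j)).

Definition csum (A B : cobj) : cobj :=
  CObj (rep_sum (cmod A) (cmod B)) (fun i => (cshift A i + cshift B i)%N).

Definition is_P (j : 'I_n) (A : cobj) : Prop :=
  exists2 P, projective_at j P & ciso A (cmodule P).

Definition is_I (j : 'I_n) (A : cobj) : Prop :=
  exists2 I, injective_at j I & ciso A (cmodule I).

(* B is isomorphic to tau^-1 A, for A indecomposable.  In the cluster category
   [1] = tau, so tau P_j = P_j[1], while tau (P_j[1]) = I_j already holds in the
   derived category; elsewhere tau is given by almost split sequences. *)
Inductive tau_inv (A B : cobj) : Prop :=
| tau_inv_mod M N of almost_split_sequence M N
    & ciso A (cmodule M) & ciso B (cmodule N)
| tau_inv_inj j of is_I j A & ciso B (cshiftP j)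
| tau_inv_shift j of ciso A (cshiftP j) & is_P j B.

End Representations.

Definition ratfun (n : nat) : fieldType := {fraction {mpoly rat[n + n + n]}}.

Definition xvar n (r : 'I_n) : ratfun n :=
  tofrac ('X_(lshift n (lshift n r)) : {mpoly rat[n + n + n]}).
Definition yvar n (r : 'I_n) : ratfun n :=
  tofrac ('X_(lshift n (rshift n r)) : {mpoly rat[n + n + n]}).
Definition zvar n (r : 'I_n) : ratfun n :=
  tofrac ('X_(rshift (n + n) r) : {mpoly rat[n + n + n]}).

(* Numbering from 1 to n, extended by 1 outside this range; in particular
   x_0 = x_(n+1) = 1. *)
Definition from1 n (v : 'I_n -> ratfun n) (j : nat) : ratfun n :=
  if j is i.+1 then oapp v 1 (insub i) else 1.

Definition monom n (v : 'I_n -> ratfun n) (d : 'I_n -> nat) : ratfun n :=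
  \prod_r v r ^+ d r.

Definition X_formula (k : closedFieldType) n (Q : quiver n)
    (chi : kspace k -> int) (V : rep k Q) : ratfun n :=
  \sum_(e : {dffun forall i : 'I_n, 'I_(rdim V i).+1})
    (chi (quiver_grassmannian V (fun i => e i)))%:~R *
    \prod_(r : 'I_n)
      (let alpha : 'I_n -> int := fun i => (nat_of_bool (i == r))%:Z in
       xvar r ^ (- euler_form Q (fun i => (e i)%:Z) alpha
                 - euler_form Q alpha (fun i => (rdim V i)%:Z - (e i)%:Z)) *
       yvar r ^+ e r * zvar r ^+ (rdim V r - e r)).

Record cluster_character (k : closedFieldType) n (Q : quiver n)
    (chi : kspace k -> int) (X : cobj k Q -> ratfun n) : Prop := {
  cc_iso : forall A B, ciso A B -> X A = X B;
  cc_zero : X (czero k Q) = 1;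
  cc_sum : forall A B, X (csum A B) = X A * X B;
  cc_shift : forall i, X (cshiftP k Q i) = xvar i;
  cc_module : forall V : rep k Q,
    indecomposable V -> X (cmodule V) = X_formula chi V }.

Definition cdim (k : closedFieldType) n (Q : quiver n) (A : cobj k Q)
  : 'I_n -> nat := rdim (cmod A).

(* Main.v *)
Require Import Defs.
From mathcomp Require Import all_boot all_order all_algebra.
From mathcomp Require Import mpoly ring.
From Stdlib Require Classical_Prop.

Set Implicit Arguments.
Unset Strict Implicit.
Unset Printing Implicit Defensive.

Import Order.TTheory GRing.Theory Num.Theory.
Local Open Scope ring_scope.

(** The objects [(i, j)] are determined by the Auslander-Reiten translation, and
    their Laurent polynomials are then computed and compared.

    Let [I(a, m)] be the representation which is the line at the vertices of
    the half-open interval [a, m) (counted from 0), with identity maps.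
    A hom from [Y] to [I(a, m)] is a compatible family of linear forms; it is
    governed by the form at the lowest vertex, while a hom from [I(a, m)] to [Y]
    is governed by a vector at the highest one.  Hence:
    - [P_j] maps onto [I(0, j)], its map splits, and [P_j] is indecomposable, so
      it is [I(0, j)] ([projective_interval]);
    - a hom to [I(a+1, m+1)] is a split epimorphism or it factors through
      [I(a, m+1) (+) I(a+1, m)] ([interval_lift]).  An almost split sequence
      starting at [I(a, m)] can be compared with the one ending at
      [I(a+1, m+1)], and therefore ends there too ([almost_split_interval]).
    So [(i, j)] is [I(i, i+j)] ([object_interval]).

    The subrepresentations of [I(a, m)] are the [I(a, t)] with t in [a, m], and
    there is at most one in each dimension vector: the nonempty quiver
    Grassmannians are points.  The exponents of the [x_r] telescope, and
    [X_formula_interval] gives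
      X = x_a x_(m+1) \sum_(a <= t <= m)
              y_(a+1) ... y_t z_(t+1) ... z_m / (x_t x_(t+1)).
    The relation between three intervals cuts this sum in two
    ([interval_char_exchange]); for an interval of one vertex the sum has two
    terms, which are those of the relation for the simple modules.  That relation
    says that the left-hand sides of the determinantal formula satisfy the
    three-term recurrence of tridiagonal determinants ([det_exchange]). *)

(** * The exchange identities in a field *)
Section Continuant.
Variable F : fieldType.
Implicit Types x y z : nat -> F.

(** The summand of index [t] belongs to the submodule with support [a, t); the
    offsets in [y s.+1] and [z s.+1] come from vertices being counted from 0 while
    the variables are numbered from 1. *)
Definition interval_char x y z a m : F :=
  x a * x m.+1 * \sum_(a <= t < m.+1)
    (\prod_(a <= s < t) y s.+1) * (\prod_(t <= s < m) z s.+1) / (x t * x t.+1).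

Lemma telescope_shift x a m : (a <= m)%N ->
  x a * \prod_(a <= s < m) x s.+1 = \prod_(a <= s < m) x s * x m.
Proof. by move=> am; rewrite -big_nat_recl // big_nat_recr. Qed.

Lemma telescope_quotient x a t m : (forall i, x i != 0) -> (a <= t <= m)%N ->
  \prod_(a <= s < t) x s * \prod_(t <= s < m) x s.+2 / \prod_(a <= s < m) x s.+1
  = x a * x m.+1 / (x t * x t.+1).
Proof.
move=> x0 /andP[at_ tm].
have P0 (v : nat -> F) b c : (forall i, v i != 0) -> \prod_(b <= s < c) v s != 0.
  by move=> v0; rewrite prodf_seq_neq0; apply/allP=> i _; rewrite v0 implybT.
apply/eqP; rewrite eqr_div ?mulf_neq0 ?P0 //; apply/eqP.
have E1 := telescope_shift x at_; have E2 := telescope_shift (fun s => x s.+1) tm.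
rewrite (big_cat_nat at_ tm) /=.
transitivity ((\prod_(a <= s < t) x s * x t) * (x t.+1 * \prod_(t <= s < m) x s.+2)).
  by ring.
by rewrite -E1 E2; ring.
Qed.

Section Identities.
Variables x y z : nat -> F.
Hypothesis x0 : forall i, x i != 0.
Local Notation G := (interval_char x y z).

Lemma interval_char_nil a : G a a = 1.
Proof.
rewrite /interval_char big_nat1 !big_geq // mulr1 mul1r divff //.
by rewrite mulf_neq0.
Qed.

Lemma interval_char_simple j :
  x j.+1 * G j j.+1 = x j * y j.+1 + x j.+2 * z j.+1.
Proof.
rewrite /interval_char big_nat_recr //= big_nat1 !big_nat1 !big_geq // mul1r mulr1.
have := x0 j; have := x0 j.+1; have := x0 j.+2; move: (x j) (x j.+1) (x j.+2).
by move=> u v w u0 v0 w0; field; rewrite u0 v0 w0.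
Qed.

(** The summands with [t <= c] share the factor [\prod_(c <= s < b) z s.+1], those
    with [c < t] the factor [\prod_(j <= s < c.+1) y s.+1]; the two remaining sums
    are the characters of the intervals [j, c) and [c+1, b). *)
Lemma interval_char_exchange j c b : (j <= c < b)%N ->
  G j b * x c.+1 =
    G c.+1 b * x j * (\prod_(j <= s < c.+1) y s.+1)
    + G j c * x b.+1 * (\prod_(c <= s < b) z s.+1).
Proof.
case/andP=> jc cb; rewrite /interval_char.
rewrite (@big_cat_nat _ _ _ c.+1) //=; [|exact: leqW|exact: ltnW].
pose w t := \prod_(t <= s < b) z s.+1.
have -> : \sum_(j <= t < c.+1) (\prod_(j <= s < t) y s.+1) * w t / (x t * x t.+1)
  = (\sum_(j <= t < c.+1) (\prod_(j <= s < t) y s.+1)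
      * (\prod_(t <= s < c) z s.+1) / (x t * x t.+1)) * w c.
  rewrite big_distrl; apply: eq_big_nat => t /andP[_ tc] /=.
  by rewrite /w (@big_cat_nat _ _ _ c t b) //=; [ring | exact: ltnW].
have -> : \sum_(c.+1 <= t < b.+1) (\prod_(j <= s < t) y s.+1) * w t / (x t * x t.+1)
  = (\prod_(j <= s < c.+1) y s.+1) * (\sum_(c.+1 <= t < b.+1)
      (\prod_(c.+1 <= s < t) y s.+1) * w t / (x t * x t.+1)).
  rewrite big_distrr; apply: eq_big_nat => t /andP[ct _] /=.
  by rewrite (@big_cat_nat _ _ _ c.+1 j t) //=; [ring | exact: leqW].
by rewrite /w; ring.
Qed.

End Identities.
End Continuant.

(** * Tridiagonal determinants *)
Section Tridiagonal.
Variable R : comNzRingType.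

(** Expansion along the last row: the minor of its subdiagonal entry has a last
    column with a single nonzero entry, which leaves the determinant of size [n]. *)
Lemma det_tridiagonal (f : nat -> nat -> R) n :
  (forall i j, (i.+1 < j)%N || (j.+1 < i)%N -> f i j = 0) ->
  \det (\matrix_(i < n.+2, j < n.+2) f i j) =
    f n.+1 n.+1 * \det (\matrix_(i < n.+1, j < n.+1) f i j)
    - f n n.+1 * f n.+1 n * \det (\matrix_(i < n, j < n) f i j).
Proof.
move=> f0.
have minor p (g : nat -> nat -> R) :
    row' ord_max (col' ord_max (\matrix_(i < p.+1, j < p.+1) g i j))
    = \matrix_(i < p, j < p) g i j.
  by apply/matrixP=> i j; rewrite !mxE !lift_max.
pose l : 'I_n.+2 := widen_ord (leqnSn _) ord_max.
rewrite (expand_det_row _ ord_max) (bigD1 ord_max) //= (bigD1 l) /=; last first.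
  by rewrite -val_eqE /= neq_ltn ltnSn.
rewrite big1 ?addr0 => [|j /andP[jm jl]]; last first.
  rewrite mxE f0 ?mul0r //; apply/orP; right; rewrite ltnS /=.
  move: jm jl; rewrite -!val_eqE /= => jm jl.
  by have := ltn_ord j; rewrite ltnS leq_eqVlt (negPf jm) ltnS leq_eqVlt (negPf jl).
congr (_ + _); first by rewrite !mxE /cofactor minor -signr_odd oddD addbb mul1r.
(* The minor of the entry below the diagonal, expanded along its last column. *)
rewrite mxE /cofactor /= addSn -signr_odd oddS oddD addbb expr1.
rewrite (expand_det_col _ ord_max) (bigD1 ord_max) //= big1 ?addr0 => [|i im]; last first.
  rewrite !mxE f0 ?mul0r //; apply/orP; left.
  rewrite lift_max /= /bump leqnn add1n ltnS.
  by move: im; rewrite -val_eqE /= => im; have := ltn_ord i; rewrite ltnS leq_eqVlt (negPf im).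
rewrite !mxE /cofactor -signr_odd oddD addbb mul1r lift_max /= /bump leqnn add1n.
have -> : row' ord_max (col' ord_max (row' ord_max (col' l
    (\matrix_(i < n.+2, j < n.+2) f i j)))) = \matrix_(i < n, j < n) f i j.
  apply/matrixP=> i j; rewrite !mxE !lift_max; congr f.
  by rewrite /= /bump !(leqNgt n j) !ltn_ord !add0n leqNgt ltn_ord.
by rewrite mulN1r mulrN mulrCA mulrA.
Qed.

Definition tridiagonal (x y z X : nat -> R) (r c : nat) : R :=
  if c == r then (if r == 0%N then x 1%N else X r.-1)
  else if c == r.+1 then y c
  else if r == c.+1 then (if c == 0%N then 1 else z c)
  else 0.

(** By the relation [xX] both sides obey the recurrence of [det_tridiagonal].  The
    induction carries the value of two consecutive determinants; the second one is
    multiplied by the subdiagonal entry that comes with it, which is 1 rather than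
    a [z] in the first step. *)
Lemma det_exchange (x y z X : nat -> R) n : x 0%N = 1 ->
  (forall j, (j < n)%N -> x j.+1 * X j = x j * y j.+1 + x j.+2 * z j.+1) ->
  forall j, (j < n)%N ->
    \det (\matrix_(r < j.+1, c < j.+1) tridiagonal x y z X r c)
    = \prod_(1 <= r < j.+1) z r * x j.+1.
Proof.
move=> x0 xX; pose D j := \det (\matrix_(r < j, c < j) tridiagonal x y z X r c).
suff H j : (j < n)%N -> D j.+1 = \prod_(1 <= r < j.+1) z r * x j.+1
    /\ (if j == 0%N then 1 else z j) * D j = \prod_(1 <= r < j.+1) z r * x j.
  by move=> j /H[].
elim: j => [_|j IH jn].
  rewrite big_geq // mul1r /D det_mx11 det_mx00 mxE /=.
  by rewrite mulr1 mul1r x0.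
have [Dj1 Dj] := IH (ltnW jn); rewrite /= Dj1.
split; last by rewrite [in RHS]big_nat_recr //=; ring.
rewrite /D det_tridiagonal -/(D j) -/(D j.+1); last first.
  move=> r c; rewrite /tridiagonal.
  case: eqP => [->|_]; first by rewrite orbb ltnNge leqnSn.
  case: eqP => [->|_]; first by rewrite ltnn ltnNge !leqW.
  by case: eqP => // ->; rewrite ltnn ltnNge !leqW.
rewrite Dj1 /tridiagonal !eqxx /= (ltn_eqF (ltnSn j)) (gtn_eqF (ltnSn j)) /=.
rewrite (ltn_eqF (leqnSn j.+1)).
rewrite -mulrA Dj [in RHS]big_nat_recr //=.
have := xX j (ltnW jn); move: (\prod_(_ <= _ < _) _) => P E.
transitivity (P * (x j.+1 * X j) - P * (x j * y j.+1)); first by ring.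
by rewrite E; ring.
Qed.

End Tridiagonal.

(** * Representations of a quiver *)
Section Ones.
Variable R : pzRingType.

(** Matrices of ones whose dimensions are booleans are the maps between spaces of
    dimension at most 1 which are the identity whenever both spaces are lines. *)
Lemma mulmx_ones p q r :
  (const_mx 1 : 'M[R]_(p, q)) *m (const_mx 1 : 'M_(q, r)) = const_mx q%:R.
Proof.
apply/matrixP=> i j; rewrite !mxE (eq_bigr (fun _ => 1)); last first.
  by move=> l _; rewrite !mxE mulr1.
by rewrite sumr_const card_ord.
Qed.

Lemma ones_bool (b : bool) : const_mx 1 = 1%:M :> 'M[R]_b.
Proof.
case: b; last by rewrite [LHS]flatmx0 [RHS]flatmx0.
by apply/matrixP=> i j; rewrite !ord1 !mxE eqxx.
Qed.

Lemma mulmx_onesT p (b : bool) r : b ->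
  (const_mx 1 : 'M[R]_(p, b)) *m (const_mx 1 : 'M_(b, r)) = const_mx 1.
Proof. by move=> bT; rewrite mulmx_ones bT. Qed.

Lemma mulmx_onesF p (b : bool) r : ~~ b ->
  (const_mx 1 : 'M[R]_(p, b)) *m (const_mx 1 : 'M_(b, r)) = 0.
Proof. by move=> bF; rewrite mulmx_ones (negPf bF); exact: raddf0. Qed.

Lemma rows_false (b : bool) r (A B : 'M[R]_(b, r)) : ~~ b -> A = B.
Proof. by case: b A B => // A B _; rewrite [A]flatmx0 [B]flatmx0. Qed.

Lemma cols_false r (b : bool) (A B : 'M[R]_(r, b)) : ~~ b -> A = B.
Proof. by case: b A B => // A B _; rewrite [A]thinmx0 [B]thinmx0. Qed.

End Ones.

Lemma ker_factor (F : fieldType) p q r (A : 'M[F]_(p, q)) (B : 'M[F]_(p, r)) :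
  kermx A *m B = 0 -> exists C, B = A *m C.
Proof.
move=> AB0; exists (pinvmx A *m B).
apply/eqP; rewrite mulmxA -subr_eq0 -{1}[B]mul1mx -mulmxBl.
have: ((1%:M - A *m pinvmx A) <= kermx A)%MS.
  by rewrite sub_kermx mulmxBl mul1mx mulmxKpV ?subrr.
by case/submxP=> D ->; rewrite -mulmxA AB0 mulmx0.
Qed.

Section Rep.
Variables (k : closedFieldType) (n : nat) (Q : quiver n).
Implicit Types U V W : rep k Q.

Lemma is_hom_id V : is_hom (hom_id V).
Proof. by move=> a; rewrite /hom_id mulmx1 mul1mx. Qed.

Lemma is_hom_comp U V W (f : hom_family U V) (g : hom_family V W) :
  is_hom f -> is_hom g -> is_hom (fun i => f i *m g i).
Proof. by move=> fH gH a; rewrite mulmxA fH -mulmxA gH mulmxA. Qed.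

Lemma is_homD V W (f g : hom_family V W) :
  is_hom f -> is_hom g -> is_hom (fun i => f i + g i).
Proof. by move=> fH gH a; rewrite mulmxDl mulmxDr fH gH. Qed.

Lemma is_homB V W (f g : hom_family V W) :
  is_hom f -> is_hom g -> is_hom (fun i => f i - g i).
Proof. by move=> fH gH a; rewrite mulmxBl mulmxBr fH gH. Qed.

Lemma rep_iso_sym V W : rep_iso V W -> rep_iso W V.
Proof. by case=> f [g [fH gH fg gf]]; exists g, f. Qed.

Lemma rep_iso_trans U V W : rep_iso U V -> rep_iso V W -> rep_iso U W.
Proof.
move=> [f [g [fH gH fg gf]]] [f' [g' [fH' gH' fg' gf']]].
exists (fun i => f i *m f' i), (fun i => g' i *m g i).
split; try exact: is_hom_comp.
  by move=> i; rewrite mulmxA -(mulmxA (f i)) fg' mulmx1 fg.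
by move=> i; rewrite mulmxA -(mulmxA (g' i)) gf mulmx1 gf'.
Qed.

Lemma rep_iso_dim V W : rep_iso V W -> rdim V =1 rdim W.
Proof.
case=> f [g [_ _ fg gf]] i; apply/eqP; rewrite eqn_leq.
have rle p q (A : 'M[k]_(p, q)) B : A *m B = 1%:M -> (p <= q)%N.
  move=> AB; rewrite -(mxrank1 k p) -AB.
  by apply: leq_trans (mxrankM_maxl _ _) (rank_leq_col _).
by rewrite (rle _ _ _ _ (fg i)) (rle _ _ _ _ (gf i)).
Qed.

(** The idempotent [1 - p s] splits [V] as [W (+) K], with [K] spanned by a basis
    of its row space; [K] vanishes because [V] is indecomposable and [W] is not 0. *)
Lemma split_epi_indec V W (s : hom_family W V) (p : hom_family V W) :
  indecomposable V -> ~ is_zero W -> is_hom s -> is_hom p ->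
  (forall i, s i *m p i = 1%:M) -> rep_iso V W.
Proof.
move=> [_ decV] W0 sH pH sp.
pose e i := 1%:M - p i *m s i.
have ep i : e i *m p i = 0.
  by rewrite /e mulmxBl mul1mx -mulmxA sp mulmx1 subrr.
have [b [b_free b_span]] : exists b : forall i, 'M[k]_(\rank (e i), rdim V i),
    (forall i, row_free (b i)) /\ (forall i, (b i :=: e i)%MS).
  exists (fun i => row_base (e i)).
  by split=> i; [exact: row_base_free | exact: eq_row_base].
pose q i := e i *m pinvmx (b i).
have qb i : q i *m b i = e i.
  by rewrite /q mulmxKpV // b_span.
have [c bE] : exists c, forall i, b i = c i *m e i.
  exists (fun i => b i *m pinvmx (e i)) => i.
  by rewrite mulmxKpV // b_span.
have ee i : e i *m e i = e i.
  by rewrite {2}/e mulmxBr mulmx1 mulmxA ep mul0mx subr0.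
have be i : b i *m e i = b i by rewrite {1}bE -mulmxA ee -bE.
have bp i : b i *m p i = 0 by rewrite bE -mulmxA ep mulmx0.
have bq i : b i *m q i = 1%:M.
  apply: (row_free_inj (b_free i)).
  by rewrite mul1mx -mulmxA qb be.
have sq i : s i *m q i = 0.
  have se : s i *m e i = 0 by rewrite /e mulmxBr mulmx1 mulmxA sp mul1mx subrr.
  by rewrite /q mulmxA se mul0mx.
have eq i : e i *m q i = q i by rewrite /q mulmxA ee.
have eH : is_hom (e : hom_family V V).
  by apply: is_homB (is_hom_comp pH sH); exact: is_hom_id.
clearbody q.
pose K : rep k Q := @Rep k n Q (fun i => \rank (e i))
  (fun a => b (src a) *m rmap V a *m q (tgt a)).
have isoVK : rep_iso V (rep_sum W K).
  exists (fun i => row_mx (p i) (q i)), (fun i => col_mx (s i) (b i)).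
  split=> [a|a|i|i].
  - rewrite /= mul_mx_row mul_row_block !mulmx0 addr0 add0r pH; congr row_mx.
    by rewrite !mulmxA qb -eH -mulmxA eq.
  - rewrite /= mul_block_col mul_col_mx !mul0mx addr0 add0r sH; congr col_mx.
    by rewrite -mulmxA qb -mulmxA eH mulmxA be.
  - by rewrite mul_row_col qb addrC subrK.
  - by rewrite mul_col_row sp sq bp bq -scalar_mx_block.
case: (decV _ _ isoVK) => // K0.
exists p, s; split=> // i; apply/esym/eqP; rewrite -subr_eq0.
by rewrite -mxrank_eq0; apply/eqP; exact: K0.
Qed.

(** The cokernel property of the right-hand map of a short exact sequence. *)
Lemma coker_factor (M E N Y : rep k Q) (f : hom_family M E)
    (g : hom_family E N) (h : hom_family E Y) :
  short_exact f g -> is_hom h -> (forall i, f i *m h i = 0) ->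
  factors_through_source g h.
Proof.
move=> [_ [gH gfull] ex] hH fh.
have gpg i : pinvmx (g i) *m g i = 1%:M.
  by apply: mulVpmx; exact: gfull.
have gE i : h i = g i *m (pinvmx (g i) *m h i).
  have kh : kermx (g i) *m h i = 0.
    have: (kermx (g i) <= f i)%MS by rewrite (ex i).
    by case/submxP=> D ->; rewrite -mulmxA fh mulmx0.
  have [C hE] := ker_factor kh.
  by rewrite {2}hE (mulmxA (pinvmx _)) gpg mul1mx.
exists (fun i => pinvmx (g i) *m h i) => // a.
apply: (row_full_inj (gfull (src a))).
by rewrite mulmxA -gH -mulmxA -gE mulmxA -gE hH.
Qed.

End Rep.

(** * Interval representations of the linear quiver *)
Section Linear.
Variables (k : closedFieldType) (n : nat).
Local Notation Q := (linear_quiver n).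
Implicit Types V W Y : rep k Q.

Definition edge (r s : 'I_n) (rs : (r : nat) == s.+1) : arrow Q := exist _ (r, s) rs.

Lemma is_hom_edges V W (f : hom_family V W) :
  (forall (r s : 'I_n) (rs : (r : nat) == s.+1),
     rmap V (edge rs) *m f s = f r *m rmap W (edge rs)) -> is_hom f.
Proof. by move=> H [[r s] rs]; exact: H. Qed.

Lemma is_hom_edge V W (f : hom_family V W) (r s : 'I_n) (rs : (r : nat) == s.+1) :
  is_hom f -> rmap V (edge rs) *m f s = f r *m rmap W (edge rs).
Proof. by move=> fH; exact: (fH (edge rs)). Qed.

(** The structure map from [r] to [s] if there is an arrow, and 0 otherwise: total
    in the two vertices, so that it can be iterated. *)
Definition edge_map V (r s : 'I_n) : 'M[k]_(rdim V r, rdim V s) :=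
  match @idP ((r : nat) == s.+1) with
  | ReflectT rs => rmap V (edge rs)
  | ReflectF _ => 0
  end.

Lemma edge_mapE V (r s : 'I_n) (rs : (r : nat) == s.+1) : edge_map V r s = rmap V (edge rs).
Proof.
rewrite /edge_map; case: {-}_ / idP => [rs'|/(_ rs)//].
by rewrite (bool_irrelevance rs' rs).
Qed.

Lemma edge_map0 V (r s : 'I_n) : (r : nat) != s.+1 -> edge_map V r s = 0.
Proof. by move=> rs; rewrite /edge_map; case: {-}_ / idP => // rs'; case/negP: rs. Qed.

(** The sum over all paths of length [d]; there is at most one of them. *)
Fixpoint walk V (d : nat) (r s : 'I_n) : 'M[k]_(rdim V r, rdim V s) :=
  if d is d'.+1 then \sum_t edge_map V r t *m walk V d' t s
  else \matrix_(i, j) ((r == s) && (i == j :> nat))%:R.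

Definition path_map V (r s : 'I_n) := walk V (r - s) r s.

Lemma path_map_id V r : path_map V r r = 1%:M.
Proof.
by rewrite /path_map subnn /=; apply/matrixP=> i j; rewrite !mxE eqxx.
Qed.

Lemma path_mapl V (r s t : 'I_n) (rt : (r : nat) == t.+1) : (s <= t)%N ->
  path_map V r s = rmap V (edge rt) *m path_map V t s.
Proof.
move=> st; rewrite /path_map (eqP rt) subSn //= (bigD1 t) //= -edge_mapE.
rewrite big1 ?addr0 // => u ut; rewrite edge_map0 ?mul0mx //.
by rewrite (eqP rt) eqSS eq_sym; apply: contra ut => /eqP/val_inj->.
Qed.

Lemma path_mapr V (r s t : 'I_n) (ts : (t : nat) == s.+1) : (t <= r)%N ->
  path_map V r s = path_map V r t *m rmap V (edge ts).
Proof.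
move: {2}(r - t)%N (erefl (r - t)%N) => d; elim: d r => [|d IH] r rtd tr.
  have/eqP: (t == r :> nat) by rewrite eqn_leq tr -subn_eq0 rtd.
  move=> /val_inj rt; subst r.
  by rewrite path_map_id mul1mx (path_mapl _ ts) // path_map_id mulmx1.
have tltr : (t < r)%N by rewrite -subn_gt0 rtd.
have r0 : (r.-1 < n)%N by apply: leq_ltn_trans (leq_pred _) (ltn_ord r).
have ru : (r : nat) == (Ordinal r0).+1 by rewrite /= prednK // (leq_trans _ tltr).
have tu : (t <= Ordinal r0)%N by rewrite -ltnS -(eqP ru).
rewrite !(path_mapl _ ru) //; last by rewrite (leq_trans _ tu) // (eqP ts).
rewrite IH ?mulmxA //.
by apply: succn_inj; rewrite -rtd -subSn // -(eqP ru).
Qed.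

Lemma hom_path V W (f : hom_family V W) (r s : 'I_n) : is_hom f -> (s <= r)%N ->
  path_map V r s *m f s = f r *m path_map W r s.
Proof.
move=> fH; move: {2}(r - s)%N (erefl (r - s)%N) => d.
elim: d s => [|d IH] s rsd sr.
  have/eqP: (s == r :> nat) by rewrite eqn_leq sr -subn_eq0 rsd.
  by move=> /val_inj rs; subst r; rewrite !path_map_id mulmx1 mul1mx.
have sltr : (s < r)%N by rewrite -subn_gt0 rsd.
have t0 : (s.+1 < n)%N by apply: leq_ltn_trans sltr (ltn_ord r).
have ts : (Ordinal t0 : nat) == s.+1 by [].
rewrite !(path_mapr _ ts) // -mulmxA (is_hom_edge _ fH) mulmxA IH ?mulmxA //.
by rewrite /= subnS rsd.
Qed.

Definition interval_rep (a m : nat) : rep k Q :=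
  @Rep k n Q (fun r => nat_of_bool (a <= r < m)%N) (fun _ => const_mx 1).

Lemma interval_not_zero a m : (a < m <= n)%N -> ~ is_zero (interval_rep a m).
Proof.
case/andP=> am mn /(_ (Ordinal (leq_trans am mn))) /=.
by rewrite leqnn am.
Qed.

Lemma path_interval a m (r s : 'I_n) : (a <= s)%N -> (s <= r < m)%N ->
  path_map (interval_rep a m) r s = const_mx 1.
Proof.
move=> as_ /andP[sr rm]; move: {2}(r - s)%N (erefl (r - s)%N) => d.
elim: d s as_ sr => [|d IH] s as_ sr rsd.
  have/eqP: (s == r :> nat) by rewrite eqn_leq sr -subn_eq0 rsd.
  by move=> /val_inj rs; subst r; rewrite path_map_id ones_bool.
have sltr : (s < r)%N by rewrite -subn_gt0 rsd.
have t0 : (s.+1 < n)%N by apply: leq_ltn_trans sltr (ltn_ord r).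
have ts : (Ordinal t0 : nat) == s.+1 by [].
rewrite (path_mapr _ ts) // IH //=; last by rewrite subnS rsd.
  by rewrite mulmx_onesT //= (leqW as_) (leq_ltn_trans sltr).
exact: leqW.
Qed.

(** Only the compatibility at arrows that end inside the interval matters: for an
    arrow entering from above the source term is 0, which gives the [else] case. *)
Lemma is_hom_to_interval Y a m (phi : forall r, 'cV[k]_(rdim Y r)) :
  (forall (r s : 'I_n) (rs : (r : nat) == s.+1), (a <= s < m)%N ->
     rmap Y (edge rs) *m phi s = if (r < m)%N then phi r else 0) ->
  is_hom ((fun r => phi r *m const_mx 1) : hom_family Y (interval_rep a m)).
Proof.
move=> H; apply: is_hom_edges => r s rs /=.
have [sI|sI] := boolP (a <= s < m)%N; last exact: cols_false.
rewrite mulmxA H // -mulmxA.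
have -> : (if (r < m)%N then phi r else 0) = if (a <= r < m)%N then phi r else 0.
  by case/andP: sI => as_ _; rewrite (eqP rs) leqW.
case: ifPn => rI; first by rewrite mulmx_onesT.
by rewrite mulmx_onesF // mulmx0 mul0mx.
Qed.

(** A vector [y] at the top vertex [c] spreads along the paths; it defines a hom as
    soon as it dies when leaving the interval at the bottom. *)
Lemma is_hom_from_interval Y a (c : 'I_n) (y : 'rV[k]_(rdim Y c)) :
  (forall b : 'I_n, b.+1 = a -> y *m path_map Y c b = 0) -> (a <= c)%N ->
  is_hom ((fun r => const_mx 1 *m y *m path_map Y c r) : hom_family (interval_rep a c.+1) Y).
Proof.
move=> H ac; apply: is_hom_edges => r s rs /=.
have [rI|rI] := boolP (a <= r < c.+1)%N; last exact: rows_false.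
case/andP: (rI) => ar rc.
rewrite -!mulmxA -path_mapr // !mulmxA.
have [sI|sI] := boolP (a <= s < c.+1)%N; first by rewrite mulmx_onesT.
rewrite mulmx_onesF // !mul0mx -mulmxA H ?mulmx0 //.
apply/eqP; rewrite eqn_leq -{2}(eqP rs) ar andbT ltnNge.
by apply: contra sI => ->; rewrite -(eqP rs) ltnW.
Qed.

Definition ones_hom a m a' m' : hom_family (interval_rep a m) (interval_rep a' m') :=
  fun r => const_mx 1.

Lemma is_hom_ones a m a' m' : (a <= a')%N -> (m <= m')%N -> is_hom (ones_hom a m a' m').
Proof.
move=> aa mm; apply: is_hom_edges => r s rs /=; rewrite !mulmx_ones.
have [/andP[ar rm]|rI] := boolP (a <= r < m)%N; last exact: rows_false.
have [/andP[as_ sm]|sI] := boolP (a' <= s < m')%N; last exact: cols_false.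
have sr : (s < r)%N by rewrite (eqP rs).
by rewrite (leq_trans aa as_) (ltn_trans sr rm) (leq_trans as_ (ltnW sr)) (leq_trans rm mm).
Qed.

(** [I(a, m)] is the subrepresentation of [I(a, m+1)] that vanishes at the top. *)
Lemma factor_sub Y a m (f : hom_family Y (interval_rep a m.+1)) :
  is_hom f -> (forall c : 'I_n, c = m :> nat -> f c = 0) ->
  exists2 w : hom_family Y (interval_rep a m), is_hom w &
    forall r, f r = w r *m ones_hom a m a m.+1 r.
Proof.
move=> fH f0; exists (fun r => f r *m const_mx 1) => [|r].
  apply: is_hom_edges => r s rs /=.
  have [/andP[as_ sm]|sI] := boolP (a <= s < m)%N; last exact: cols_false.
  have ar : (a <= r)%N by rewrite (eqP rs) leqW.
  have rm : (r <= m)%N by rewrite (eqP rs).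
  rewrite mulmxA (is_hom_edge rs fH) -!mulmxA /= mulmx_onesT ?as_ ?leqW //.
  have [rI|rI] := boolP (a <= r < m)%N; first by rewrite mulmx_onesT.
  suff rm' : r = m :> nat by rewrite f0 // !mul0mx.
  by apply/eqP; rewrite eqn_leq rm leqNgt; rewrite ar in rI.
rewrite /ones_hom -mulmxA.
have [rI|ar] := boolP (a <= r < m)%N.
  by rewrite mulmx_onesT // ones_bool mulmx1.
have [/andP[a_r rm]|rI] := boolP (a <= r < m.+1)%N; last exact: cols_false.
rewrite f0 ?mul0mx //; apply/eqP; rewrite eqn_leq -ltnS rm leqNgt.
by rewrite a_r in ar.
Qed.

(** Let [c = m] be the top vertex, [chi] the linear form given by [f] at [c], and
    [b = a] the vertex just below the interval.  A vector killed on its way from [c]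
    to [b] with [chi] nonzero on it would provide a section of [f].  Otherwise
    [chi] is the pullback of a form [phi] at [b], and pulling [phi] back to the
    vertices between [b] and [c] gives [g]; then [f] and [g] agree at the top vertex, so that their
    difference lands in [I(a+1, m)]. *)
Lemma interval_lift Y a m (f : hom_family Y (interval_rep a.+1 m.+1)) :
  (a < m < n)%N -> is_hom f -> ~ split_epi f ->
  exists (g : hom_family Y (interval_rep a m.+1)) (h : hom_family Y (interval_rep a.+1 m)),
    [/\ is_hom g, is_hom h & forall r,
      f r = g r *m ones_hom a m.+1 a.+1 m.+1 r + h r *m ones_hom a.+1 m a.+1 m.+1 r].
Proof.
case/andP=> am mn fH nsf.
pose c := Ordinal mn; pose b := Ordinal (ltn_trans am mn).
have [chi chidef] : exists chi : 'cV_(rdim Y c), chi = f c *m const_mx 1.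
  by exists (f c *m const_mx 1).
have chiE : f c = chi *m const_mx 1.
  by rewrite chidef -mulmxA (@mulmx_onesT _ _ true) // ones_bool mulmx1.
have [phi phiE] : exists phi, chi = path_map Y c b *m phi.
  apply: ker_factor; apply/eqP/negPn/negP => Kchi.
  case: nsf; have [i Ki] : exists i, row i (kermx (path_map Y c b)) *m chi != 0.
    apply/existsP; apply: contraR Kchi => /existsPn H.
    apply/eqP/row_matrixP => i; rewrite row_mul row0.
    by apply/eqP; have := H i; rewrite negbK.
  set y0 := row i _ in Ki.
  have y0b : y0 *m path_map Y c b = 0 by rewrite /y0 -row_mul mulmx_ker row0.
  pose u := (y0 *m chi) 0 0.
  have uE : y0 *m chi = u%:M by exact: mx11_scalar.
  have u0 : u != 0.
    by apply: contra_neq Ki => uz; rewrite uE uz; exact: raddf0.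
  pose y := u^-1 *: y0.
  have ychi : y *m chi = 1%:M by rewrite -scalemxAl uE -mul_scalar_mx -scalar_mxM mulVf.
  have yH : is_hom ((fun r => const_mx 1 *m y *m path_map Y c r)
      : hom_family (interval_rep a.+1 c.+1) Y).
    apply: is_hom_from_interval => // b' [b'a].
    have -> : b' = b by apply: val_inj.
    by rewrite -scalemxAl y0b scaler0.
  exists (fun r => const_mx 1 *m y *m path_map Y c r) => // r; rewrite /hom_id.
  have [rI|rI] := boolP (a.+1 <= r < m.+1)%N; last exact: rows_false.
  case/andP: (rI) => ar rm.
  rewrite /= -(mulmxA _ _ (f r)) (hom_path fH) //.
  rewrite path_interval ?leqnn ?andbT //= chiE -!mulmxA.
  rewrite mulmx_onesT ?am ?leqnn // (mulmxA y) ychi mul1mx (@mulmx_onesT _ _ true) //.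
  by rewrite ones_bool.
pose g : hom_family Y (interval_rep a m.+1) := fun r => path_map Y r b *m phi *m const_mx 1.
have gH : is_hom g.
  apply: is_hom_to_interval => r s rs /andP[as_ sm].
  rewrite mulmxA -path_mapl //; case: ifPn => //; rewrite -leqNgt => mr.
  have sc : s = c.
    by apply/val_inj/eqP; rewrite /= eqn_leq -ltnS sm -ltnS -(eqP rs) mr.
  subst s; rewrite (path_mapl _ rs) // -mulmxA -phiE chidef mulmxA.
  rewrite (is_hom_edge rs fH) -mulmxA.
  (* Above the top vertex the form [chi] pulls back to 0, as [f] is a hom. *)
  suff rI : ~~ (a < r < m.+1)%N by rewrite (cols_false (f r) 0 rI) mul0mx.
  by rewrite negb_and -[X in _ || X]leqNgt mr orbT.
have [] := @factor_sub Y a.+1 m (fun r => f r - g r *m ones_hom a m.+1 a.+1 m.+1 r).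
- by apply: is_homB fH (is_hom_comp gH _); exact: is_hom_ones.
- move=> c' /= c'm; have -> : c' = c by apply: val_inj.
  by rewrite chiE phiE /g -(mulmxA _ (const_mx 1)) mulmx_onesT ?subrr //= ltnW // leqnn.
move=> h hH hE; exists g, h; split=> // r.
by rewrite -hE addrC subrK.
Qed.

End Linear.
Arguments ones_hom : clear implicits.

(** * Projectives, injectives and almost split sequences *)
Section Identify.
Variables (k : closedFieldType) (n : nat).
Local Notation Q := (linear_quiver n).
Local Notation interval_rep := (interval_rep k n).
Implicit Types V W Y : rep k Q.

(** A retraction would be the identity at the vertex [m-1]; but its value there
    factors through its value at [m], where [I(a, m)] is 0. *)
Lemma interval_sub_nonsplit a m : (a < m < n)%N ->
  ~ split_mono (ones_hom k n a m a m.+1).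
Proof.
case/andP=> am mn [u uH uE].
have m0 : (m.-1 < n)%N by apply: leq_ltn_trans (leq_pred m) mn.
pose c := Ordinal mn; pose b := Ordinal m0.
have cb : (c : nat) == b.+1 by rewrite /= (ltn_predK am).
have bI : (a <= b < m)%N by rewrite /= -ltnS (ltn_predK am) am leqnn.
have cI : (a <= c < m.+1)%N by rewrite /= ltnW //=.
have cI' : ~~ (a <= c < m)%N by rewrite /= ltnn andbF.
have := is_hom_edge cb uH; rewrite /= (cols_false (u c) 0 cI') mul0mx.
move/(congr1 (mulmx (const_mx 1 : 'M_(a <= b < m, a <= c < m.+1)))).
rewrite mulmx0 mulmxA mulmx_onesT //.
have := uE b; rewrite /hom_id /ones_hom => <- => /matrixP.
by rewrite /= bI => /(_ ord0 ord0); rewrite !mxE eqxx => /eqP; rewrite oner_eq0.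
Qed.

Lemma interval_quot_nonsplit a m : (a < m <= n)%N ->
  ~ split_mono (ones_hom k n a m a.+1 m).
Proof.
case/andP=> am mn [u uH uE].
pose c := Ordinal (leq_trans am mn).
have := uE c; rewrite /hom_id /ones_hom.
have cI : ~~ (a < c < m)%N by rewrite /= ltnn.
rewrite (cols_false (const_mx 1) 0 cI) mul0mx /= leqnn am => /matrixP/(_ ord0 ord0).
by rewrite !mxE => /eqP; rewrite oner_eq0.
Qed.

(** An injective [I(a, m)] would make its embedding in [I(a, m+1)] split. *)
Lemma interval_not_injective a m (j : 'I_n) (I : rep k Q) : (a < m < n)%N ->
  rep_iso I (interval_rep a m) -> ~ injective_at j I.
Proof.
move=> amn [f [g [fH gH fg gf]]] [_ injI _].
apply: (interval_sub_nonsplit amn).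
have [|u uH uE] := injI _ _ (ones_hom k n a m a m.+1) g _ gH.
  split; first exact: is_hom_ones.
  move=> r; rewrite /ones_hom; apply/row_freeP; exists (const_mx 1).
  have [rI|rI] := boolP (a <= r < m)%N; last exact: rows_false.
  have [/= ar rm] := andP rI.
  by rewrite mulmx_onesT ?ones_bool //= ar ltnW.
exists (fun r => u r *m f r); first exact: is_hom_comp.
by move=> r; rewrite mulmxA -uE gf.
Qed.

(** The hom to the simple at [j] lifts along [I(0, j+1) -> S_j] to a hom [p] from
    [P]; a vector on which [p] is 1 at the top vertex [j] spreads to a section of
    [p], and [P] is indecomposable. *)
Lemma projective_interval (j : 'I_n) (P : rep k Q) :
  projective_at j P -> rep_iso P (interval_rep 0 j.+1).
Proof.
case=> indP projP [h hH [i0 hi0]].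
pose top : hom_family (interval_rep 0 j.+1) (rep_simple k Q j) :=
  fun i => const_mx 1.
have ji0 : i0 = j.
  apply/eqP/negPn/negP=> ij; move: hi0.
  by rewrite (cols_false (h i0) 0 ij) eqxx.
subst i0.
have topH : is_hom top.
  apply: is_hom_edges => r s rs /=; rewrite mulmx0 /top.
  have [sj|sj] : (s == j) \/ ~~ (s == j) by case: (s == j); [left | right].
    2: exact: cols_false.
  apply: rows_false; rewrite (eqP rs) /= -leqNgt (eqP sj) //.
have topE : epi top.
  split=> // i; rewrite /top /=.
  have [ij|ij] : (i == j) \/ ~~ (i == j) by case: (i == j); [left | right].
    2: by apply/row_fullP; exists 0; apply: rows_false.
  by rewrite (eqP ij) eqxx leqnn (ones_bool _ true) /row_full mxrank1.
have [p pH pE] := projP _ _ top h topE hH.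
pose chi : 'cV_(rdim P j) := p j *m const_mx 1.
have chi0 : chi != 0.
  apply: contra hi0 => /eqP chi0; rewrite pE.
  suff -> : p j = chi *m const_mx 1 by rewrite chi0 !mul0mx.
  by rewrite /chi -mulmxA (@mulmx_onesT _ _ true) // ones_bool mulmx1.
have [y ychi] : exists y : 'rV_(rdim P j), y *m chi = 1%:M.
  case/matrix0Pn: chi0 => i [o]; rewrite ord1 => io.
  exists ((chi i 0)^-1 *: row i 1%:M); rewrite -scalemxAl -row_mul mul1mx.
  by rewrite [LHS]mx11_scalar mxE [X in _ * X]mxE mulVf.
apply: (@split_epi_indec _ _ _ _ _ (fun r => const_mx 1 *m y *m path_map P j r) p) => //.
- by apply: interval_not_zero; rewrite ltn_ord.
- exact: is_hom_from_interval.
move=> r; have [/= rj|rI] := boolP (0 <= r < j.+1)%N; last exact: rows_false.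
rewrite -mulmxA (hom_path pH) //.
rewrite path_interval ?ltnS ?leqnn ?andbT //.
rewrite -[p j]mulmx1 -(ones_bool _ (0 <= j < j.+1)%N).
rewrite -(@mulmx_onesT _ _ true) // !mulmxA -(mulmxA _ (p j)) -/chi.
rewrite -(mulmxA _ y) ychi mulmx1 -mulmxA mulmx_onesT ?leqnn //.
by rewrite (@mulmx_onesT _ _ true) ?ones_bool.
Qed.

(** The inclusion and the projection of [I(a, m)] do not split, so they factor
    through [f] as [v1] and [v2], and induce [h : N -> I(a+1, m+1)] on the cokernel.
    If [h] has a section [u], then [u] is a split epimorphism (hence the inverse of
    [h]): otherwise [h u] and [1 - h u] would both factor through [g], and [g] would
    split.  If [h] has none, [interval_lift] lifts it, and correcting [v1] by this
    lift makes it vanish at the top vertex, hence come from a hom [E -> I(a, m)];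
    followed by the isomorphism with [M], this is a retraction of [f]. *)
Lemma almost_split_interval a m (M N : rep k Q) : (a < m < n)%N ->
  almost_split_sequence M N -> rep_iso M (interval_rep a m) ->
  rep_iso N (interval_rep a.+1 m.+1).
Proof.
move=> amn [E [f [g [ex [fH nsf fac] [gH nsg facg]]]]] [s [t [sH tH st ts]]].
have [am mn] := andP amn.
have amn' : (a < m <= n)%N by rewrite am ltnW.
have nsplit W (al : hom_family (interval_rep a m) W) :
    ~ split_mono al -> ~ split_mono (fun i => s i *m al i).
  move=> nal [u uH uE]; apply: nal; exists (fun i => u i *m s i).
    exact: is_hom_comp.
  move=> i; have := uE i; rewrite /hom_id => uEi.
  rewrite mulmxA -[al i *m u i]mul1mx -(ts i) -(mulmxA (t i)) (mulmxA (s i)).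
  by rewrite -uEi mulmx1.
pose al := ones_hom k n a m a m.+1; pose be := ones_hom k n a m a.+1 m.
pose pi := ones_hom k n a m.+1 a.+1 m.+1; pose io := ones_hom k n a.+1 m a.+1 m.+1.
have alH : is_hom al by exact: is_hom_ones.
have beH : is_hom be by exact: is_hom_ones.
have piH : is_hom pi by exact: is_hom_ones.
have ioH : is_hom io by exact: is_hom_ones.
have [v1 v1H v1E] := fac _ (fun i => s i *m al i) (is_hom_comp sH alH)
  (nsplit _ _ (interval_sub_nonsplit amn)).
have [v2 v2H v2E] := fac _ (fun i => s i *m be i) (is_hom_comp sH beH)
  (nsplit _ _ (interval_quot_nonsplit amn')).
have alpi r : al r *m pi r = be r *m io r.
  rewrite /al /pi /be /io /ones_hom /=.
  have [/andP[ar rm]|rI] := boolP (a <= r < m)%N; last exact: rows_false.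
  have [/andP[ar' rm']|rI] := boolP (a < r < m.+1)%N; last exact: cols_false.
  by rewrite !mulmx_onesT ?ar ?ar' ?rm ?rm'.
have fg i : f i *m g i = 0.
  by apply/eqP; rewrite -sub_kermx; case: ex => _ _ /(_ i) <-.
have kill i : f i *m (v1 i *m pi i - v2 i *m io i) = 0.
  by rewrite mulmxBr !mulmxA -v1E -v2E -!mulmxA alpi subrr.
have [h hH hE] := coker_factor ex
  (is_homB (is_hom_comp v1H piH) (is_hom_comp v2H ioH)) kill.
have [[u uH uE]|nsh] : split_epi h \/ ~ split_epi h by exact: Classical_Prop.classic.
  have I0 : ~ is_zero (interval_rep a.+1 m.+1) by exact: interval_not_zero.
  have [[t' tH' tE]|nsu] : split_epi u \/ ~ split_epi u by exact: Classical_Prop.classic.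
    have hu i : h i *m u i = 1%:M.
      rewrite -[h i]mul1mx -[1%:M]/(hom_id _ i) tE -(mulmxA (t' i)).
      by rewrite -uE /hom_id mulmx1 -tE.
    by exists h, u; split=> // i; rewrite -uE.
  have [w wH wE] := facg _ u uH nsu.
  have eH : is_hom ((fun i => 1%:M - h i *m u i) : hom_family N N).
    by apply: is_homB (is_hom_id N) _; exact: is_hom_comp.
  have [|w' wH' wE'] := facg _ _ eH.
    case=> [q qH qE]; apply: I0 => i.
    have h0 : h i = 0.
      rewrite -[LHS]mul1mx -[1%:M]/(hom_id _ i) qE -mulmxA mulmxBl mul1mx.
      by rewrite -mulmxA -uE mulmx1 subrr mulmx0.
    have := uE i; rewrite h0 mulmx0 /hom_id => /(congr1 mxrank).
    by rewrite mxrank1 mxrank0.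
  case: nsg; exists (fun i => w' i + h i *m w i).
    exact: is_homD wH' (is_hom_comp hH wH).
  by move=> i; rewrite mulmxDl -mulmxA -wE -wE' /hom_id subrK.
have [psi [eta [psiH etaH hlift]]] := interval_lift amn hH nsh.
have [] := @factor_sub _ _ E a m (fun i => v1 i - g i *m psi i).
- exact: is_homB v1H (is_hom_comp gH psiH).
- move=> c cm.
  have cI : (a < c < m.+1)%N by rewrite cm am /=.
  have cI2 : (a <= c < m.+1)%N by rewrite cm ltnW /=.
  have cI' : ~~ (a < c < m)%N by rewrite cm ltnn andbF.
  have pi1 : pi c *m (const_mx 1 : 'M_(a < c < m.+1, a <= c < m.+1)) = 1%:M.
    by rewrite /pi /ones_hom mulmx_onesT ?ones_bool.
  rewrite -[LHS]mulmx1 -pi1 mulmxA mulmxBl -mulmxA.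
  have := hE c; rewrite hlift mulmxDr.
  rewrite (rows_false (io c) 0 cI') (rows_false (ones_hom _ _ _ _ _ _ c) 0 cI').
  by rewrite !mulmx0 subr0 addr0 => ->; rewrite /pi subrr mul0mx.
move=> w wH wE; case: nsf; exists (fun i => w i *m t i).
  exact: is_hom_comp.
move=> i; rewrite /hom_id.
have fw : f i *m w i = s i.
  have al_free : row_free (al i).
    apply/row_freeP; exists (const_mx 1); rewrite /al /ones_hom.
    have [rI|rI] := boolP (a <= i < m)%N; last exact: rows_false.
    by have [ar rm] := andP rI; rewrite mulmx_onesT ?ones_bool //= ar ltnW.
  apply: (row_free_inj al_free).
  by rewrite -mulmxA -wE mulmxBr mulmxA fg mul0mx subr0 -v1E.
by rewrite mulmxA fw st.
Qed.

(** An endomorphism commutes with the path maps, which are identities of lines, so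
    it is determined by its value at the top vertex. *)
Lemma interval_end_scalar a m (e : hom_family (interval_rep a m) (interval_rep a m)) :
  (a < m <= n)%N -> is_hom e -> exists lam, forall i, e i = lam%:M.
Proof.
case/andP=> am mn eH.
have m0 : (m.-1 < n)%N by rewrite (ltn_predK am).
pose c := Ordinal m0.
have cI : (a <= c < m)%N by rewrite /= -ltnS (ltn_predK am) am leqnn.
have [ac cm] := andP cI.
pose lam := ((const_mx 1 : 'M_(1, a <= c < m)) *m e c *m (const_mx 1 : 'M_(_, 1))) 0 0.
exists lam => r; have [rI|rI] := boolP (a <= r < m)%N; last exact: rows_false.
have [ar rm] := andP rI.
have rc : (r <= c)%N by rewrite -ltnS /= (ltn_predK am).
have := hom_path eH rc; rewrite path_interval ?rc //.
move/(congr1 (mulmx (const_mx 1 : 'M_(a <= r < m, a <= c < m)))).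
rewrite mulmxA mulmx_onesT // ones_bool mul1mx => ->.
have -> : e c = const_mx 1 *m (lam%:M : 'M_1) *m const_mx 1.
  rewrite /lam -mx11_scalar !mulmxA (@mulmx_onesT _ _ true) // ones_bool mul1mx.
  by rewrite -mulmxA (@mulmx_onesT _ _ true) // ones_bool mulmx1.
rewrite mul_mx_scalar -!scalemxAl -!scalemxAr -mulmxA mulmx_onesT // mulmxA.
by rewrite mulmx_onesT // (@mulmx_onesT _ _ true) // ones_bool scalemx1.
Qed.

(** The projection to the first summand of a decomposition is a scalar; if it is
    not 0, the complementary projection is 0, as their product is. *)
Lemma interval_indecomposable a m : (a < m <= n)%N -> indecomposable (interval_rep a m).
Proof.
move=> amn; split; first exact: interval_not_zero.
move=> V1 V2 [f [g [fH gH fg gf]]].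
have zero U (i : hom_family U (rep_sum V1 V2)) (p : hom_family (rep_sum V1 V2) U) :
    (forall r, i r *m p r = 1%:M) -> (forall r, f r *m (p r *m i r) *m g r = 0) ->
    is_zero U.
  move=> ip e0 r.
  have: g r *m (f r *m (p r *m i r) *m g r) *m f r = p r *m i r.
    by rewrite !mulmxA gf mul1mx -!mulmxA gf mulmx1.
  rewrite e0 mulmx0 mul0mx => pi0.
  have: (1%:M : 'M[k]_(rdim U r)) = 0.
    by rewrite -[LHS]mulmx1 -(ip r) -mulmxA (mulmxA (p r)) -pi0 mul0mx mulmx0.
  by move/(congr1 mxrank); rewrite mxrank1 mxrank0.
pose i1 : hom_family V1 (rep_sum V1 V2) := fun i => row_mx 1%:M 0.
pose p1 : hom_family (rep_sum V1 V2) V1 := fun i => col_mx 1%:M 0.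
pose i2 : hom_family V2 (rep_sum V1 V2) := fun i => row_mx 0 1%:M.
pose p2 : hom_family (rep_sum V1 V2) V2 := fun i => col_mx 0 1%:M.
have iH1 : is_hom i1.
  by move=> b; rewrite /i1 /= mul_mx_row mul_row_block !mulmx0 !mul0mx mulmx1 mul1mx !addr0.
have pH1 : is_hom p1.
  by move=> b; rewrite /p1 /= mul_block_col mul_col_mx !mulmx0 !mul0mx mulmx1 mul1mx !addr0.
have ip1 r : i1 r *m p1 r = 1%:M by rewrite /i1 /p1 mul_row_col mulmx1 mulmx0 addr0.
have ip2 r : i2 r *m p2 r = 1%:M by rewrite /i2 /p2 mul_row_col mulmx1 mulmx0 add0r.
have ip12 r : i1 r *m p2 r = 0 by rewrite /i1 /p2 mul_row_col mulmx1 mulmx0 addr0.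
have [|lam lamE] := @interval_end_scalar a m (fun r => f r *m (p1 r *m i1 r) *m g r) amn.
  exact: is_hom_comp (is_hom_comp fH (is_hom_comp pH1 iH1)) gH.
have [lam0|lam0] := eqVneq lam 0.
  by left; apply: (zero _ i1 p1) => // r; rewrite lamE lam0 raddf0.
right; apply: (zero _ i2 p2) => // r.
have: (f r *m (p1 r *m i1 r) *m g r) *m (f r *m (p2 r *m i2 r) *m g r) = 0.
  rewrite !mulmxA -(mulmxA _ (g r)) gf mulmx1.
  by rewrite -(mulmxA _ (i1 r)) ip12 mulmx0 !mul0mx.
rewrite lamE mul_scalar_mx => /eqP; rewrite scaler_eq0 (negPf lam0) => /eqP //.
Qed.

End Identify.

(** * Quiver Grassmannians of interval representations *)
Section Chi.
Variables (k : closedFieldType).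
Implicit Types X Y : kspace k.

(** For a space with at most one point this is the only structure of a variety. *)
Definition discrete Y : Prop :=
  (forall O : Y -> Prop, kopen O) /\ (forall (O : Y -> Prop) f, kreg O f).

Lemma zariski_open_const (T : Type) (I : finType) (c : I -> T -> k) (O : T -> Prop) :
  (forall x y, O x -> O y) -> @kopen k (zariski_space c) O.
Proof.
move=> Oc; exists (fun p => p = 1 /\ exists x, O x) => x; split=> [Ox|].
  by exists 1; [split=> //; exists x | rewrite /peval meval1 oner_eq0].
by case=> p [_ [y Oy]] _; exact: Oc Oy.
Qed.

Lemma zariski_reg_const (T : Type) (I : finType) (c : I -> T -> k) (O : T -> Prop) f :
  (forall x y, f x = f y) -> @kreg k (zariski_space c) O f.
Proof.
move=> fc x Ox; exists (f x)%:MP, 1; rewrite /peval meval1 oner_eq0; split=> // y _ _.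
by rewrite !meval1 mevalC divr1; exact: fc.
Qed.

(** The frame variety over a point can be large, but the subsets and functions that
    come from the quotient are constant on it. *)
Lemma discrete_quotient (T T' : Type) (I : finType) (c : I -> T -> k) (p : T -> T') :
  (forall x y : T', x = y) -> discrete (quotient_space (X := zariski_space c) p).
Proof.
move=> T1; split=> [O|O f].
  by apply: zariski_open_const => x y; rewrite (T1 (p x) (p y)).
by apply: zariski_reg_const => x y; rewrite (T1 (p x) (p y)).
Qed.

Lemma discrete_zariski (T : Type) (I : finType) (c : I -> T -> k) :
  (forall x y : T, x = y) -> discrete (zariski_space c).
Proof.
move=> T1; split=> [O|O f].
  by apply: zariski_open_const => x y; rewrite (T1 x y).
by apply: zariski_reg_const => x y; rewrite (T1 x y).
Qed.

Lemma kiso_discrete X Y (f : X -> Y) (g : Y -> X) :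
  discrete X -> discrete Y -> cancel f g -> cancel g f -> kiso X Y.
Proof. by move=> [oX rX] [oY rY] fK gK; exists f, g; split. Qed.

Lemma discrete_sub X (Z : X -> Prop) : (forall x y : X, x = y) -> discrete X ->
  discrete (sub_space Z).
Proof.
move=> X1 [oX rX].
have Z1 (x y : {x : X | Z x}) : x = y.
  case: x y => [x zx] [y zy]; case: _ / (X1 x y) zy => zy.
  by rewrite (Classical_Prop.proof_irrelevance _ zx zy).
split=> [O|O f].
  exists (fun _ => exists x, O x) => // x; split=> [Ox|[y Oy]]; first by exists x.
  by rewrite (Z1 x y).
move=> x Ox; exists (fun _ => True), (fun _ => f x); split=> // y _ _.
by rewrite (Z1 y x).
Qed.

Lemma affine_point_eq (x y : affine_space k 0) : x = y.
Proof.
case: x y => [x zx] [y zy]; have E : x = y by rewrite [x]thinmx0 [y]thinmx0.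
by case: _ / E zy => zy; rewrite (Classical_Prop.proof_irrelevance _ zx zy).
Qed.

Lemma discrete_affine_point : discrete (affine_space k 0).
Proof. exact: discrete_zariski affine_point_eq. Qed.

Definition affine_point : affine_space k 0 :=
  exist _ (0 : 'rV_0) (fun p (F : False) => match F with end).

Lemma affine_point_variety : is_variety (affine_space k 0).
Proof.
exists 1%N, (fun _ _ => True); have [oA rA] := discrete_affine_point.
have dS := discrete_sub (fun _ => True) affine_point_eq discrete_affine_point.
have [oS rS] := dS.
split=> [x|i|O|O f Oo]; try by split.
- by exists ord0.
- split=> //; exists 0%N, (fun _ => False).
  apply: (@kiso_discrete (sub_space (fun _ => True)) (affine_space k 0)
    (fun x => sval x) (fun x => exist _ x I)) => // x.
  by case: x => x [].
Qed.

Section Euler.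
Variables (chi : kspace k -> int) (Hchi : euler_characteristic chi).

Lemma chi_point Y : discrete Y -> (forall x y : Y, x = y) -> Y -> chi Y = 1.
Proof.
move=> dY Y1 y; rewrite -(chi_affine_space Hchi 0).
rewrite -(chi_iso Hchi (Y := Y) affine_point_variety) //.
apply: (kiso_discrete (f := fun _ => y) (g := fun _ => affine_point)) => //.
- exact: discrete_affine_point.
- by move=> x; exact: affine_point_eq.
Qed.

(** The empty space is the disjoint union of two copies of itself. *)
Lemma chi_empty Y : discrete Y -> (Y -> False) -> chi Y = 0.
Proof.
move=> dY Y0; have Y1 (x y : Y) : x = y by case: (Y0 x).
have [oY rY] := dY.
have vY : is_variety Y.
  exists 0%N, (fun _ _ => True); split=> [x|[]//|O|O f _]; first by case: (Y0 x).
    by split=> // _ [].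
  by split=> // _ [].
have sub (Z : Y -> Prop) : chi (sub_space Z) = chi Y.
  apply: esym; apply: (chi_iso Hchi vY).
  apply: (@kiso_discrete Y (sub_space Z) (fun y => match Y0 y with end)
    (fun x => sval x)) => //.
  - exact: discrete_sub.
  - by case=> x; case: (Y0 x).
have := chi_additive Hchi (Z := fun _ => True) vY (oY _).
rewrite !sub => E; apply: (addrI (chi Y)); rewrite addr0 -E //.
Qed.

End Euler.

Variables (n : nat).
Local Notation Q := (linear_quiver n).
Local Notation interval_rep := (interval_rep k n).

(** Every space of an interval representation is a line or 0, so a subspace is
    determined by its dimension. *)
Lemma gr_interval_eq a m e (x y : gr_point (interval_rep a m) e) : x = y.
Proof.
apply: val_inj; case: x y => [U /= /andP[/andP[/forallP Uc _] /forallP Ue]].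
case=> [V /= /andP[/andP[/forallP Vc _] /forallP Ve]].
apply/ffunP=> r; rewrite -(eqP (Uc r)) -(eqP (Vc r)); apply/genmxP.
have: \rank (U r) = \rank (V r) by rewrite (eqP (Ue r)) (eqP (Ve r)).
move: (U r) (V r) => {Uc Ue Vc Ve} A B.
have := rank_leq_row A; rewrite {2}/rdim /=.
have [rA _|rA] := eqVneq (\rank A) 0%N.
  rewrite rA => /esym/eqP rB; move/eqP: rA rB; rewrite !mxrank_eq0 => /eqP-> /eqP->.
  by rewrite submx_refl.
move=> le1 rB.
have full (C : 'M[k]_(a <= r < m)) : \rank C = \rank A -> row_full C.
  rewrite /row_full => ->; rewrite eqn_leq le1 /=; apply: leq_trans (_ : 1 <= _)%N.
    by case: (_ <= _ < _)%N.
  by rewrite lt0n.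
by rewrite !submx_full ?full.
Qed.

Lemma sub_rows_false p q (b : bool) (A : 'M[k]_(b, q)) (B : 'M_(p, q)) : ~~ b -> (A <= B)%MS.
Proof. by case: b A => // A _; rewrite [A]flatmx0 sub0mx. Qed.

Lemma sub_cols_false p q (b : bool) (A : 'M[k]_(p, b)) (B : 'M_(q, b)) : ~~ b -> (A <= B)%MS.
Proof. by case: b A B => // A B _; rewrite [A]thinmx0 sub0mx. Qed.

Definition interval_dim (a t : nat) : 'I_n -> nat := fun r => (a <= r < t)%N.

Lemma gr_interval_point a t m : (t <= m)%N ->
  gr_point (interval_rep a m) (interval_dim a t).
Proof.
move=> tm; apply: gr_of_frame.
exists [ffun r => const_mx 1]; apply/andP; split; last first.
  apply/forallP=> r; rewrite ffunE; apply/row_freeP; exists (const_mx 1).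
  rewrite /interval_dim /=.
  have [rI|rI] := boolP (a <= r < t)%N; last exact: rows_false.
  have [ar rt] := andP rI.
  by rewrite mulmx_onesT ?ones_bool // ar (leq_trans rt).
apply/andP; split; first by apply/forallP=> r; rewrite !ffunE genmx_id.
apply/forallP=> -[[r s] /= rs]; rewrite !ffunE !genmxE (eqmxMr _ (genmxE _)).
rewrite /interval_dim.
have [sM|sM] := boolP (a <= s < m)%N; last exact: sub_cols_false.
have [sI|sI] := boolP (a <= s < t)%N.
  by apply: submx_full; apply/row_fullP; exists (const_mx 1); rewrite mulmx_onesT ?ones_bool.
have rI : ~~ (a <= r < t)%N.
  apply: contra sI => /andP[_ rt]; case/andP: sM => -> _ /=.
  by apply: leq_trans rt; rewrite (eqP rs) ltnS leqW.
exact: sub_rows_false.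
Qed.

(** A nonzero member of a subrepresentation at a vertex [r] of the interval forces
    the next lower one to be nonzero, so the support is an initial segment; [t] is
    the first vertex from [a] on where the subrepresentation vanishes. *)
Lemma gr_interval_dim a m e : (m <= n)%N -> (a <= m)%N -> gr_point (interval_rep a m) e ->
  exists2 t, (a <= t <= m)%N & e =1 interval_dim a t.
Proof.
move=> mn am [U /andP[/andP[_ /forallP sub] /forallP rk]].
have e1 (r : 'I_n) : (e r <= (a <= r < m))%N.
  by rewrite -(eqP (rk r)) rank_leq_row.
have edec (r s : 'I_n) : (r : nat) == s.+1 -> (a <= s)%N -> e s = 0%N -> e r = 0%N.
  move=> rs as_ es; have := sub (edge rs); rewrite /=.
  have Us : U s = 0 by apply/eqP; rewrite -mxrank_eq0 (eqP (rk s)) es.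
  rewrite Us submx0 => /eqP Ur; apply/eqP; rewrite -(eqP (rk r)) mxrank_eq0.
  have [rI|rI] := boolP (a <= r < m)%N; last by rewrite [U r](rows_false _ 0 rI).
  have sI : (a <= s < m)%N by case/andP: rI => _; rewrite (eqP rs) as_ => /ltnW.
  have := congr1 (mulmx^~ (const_mx 1 : 'M_(a <= s < m, a <= r < m))) Ur.
  by rewrite -mulmxA mulmx_onesT // ones_bool mulmx1 mul0mx => ->.
pose e' s := if insub s is Some r then e r else 0%N.
have e'E (r : 'I_n) : e' r = e r.
  by rewrite /e' insubT // => rn; congr e; apply: val_inj.
have e'm s : (m <= s)%N -> e' s = 0%N.
  move=> ms; rewrite /e'; case: insubP => // r _ rs.
  by apply/eqP; rewrite -leqn0 (leq_trans (e1 r)) // rs (ltnNge s) ms andbF.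
have ex : exists t, (a <= t)%N && (e' t == 0%N) by exists m; rewrite am e'm.
case: (ex_minnP ex) => t /andP[at_ /eqP et] tmin.
have e't d : e' (t + d)%N = 0%N.
  elim: d => [|d IH]; first by rewrite addn0.
  rewrite addnS; rewrite {1}/e'; case: insubP => // r rn rE.
  have dn : (t + d < n)%N by apply: ltnW.
  apply: (edec r (Ordinal dn)); rewrite ?rE //=; first exact: leq_trans (leq_addr _ _).
  by rewrite -e'E.
exists t; first by rewrite at_ tmin // am e'm.
move=> r; rewrite /interval_dim; have [rt|tr] := ltnP r t; last first.
  by rewrite andbF -e'E -(subnKC tr) e't.
have [ar|ra] := leqP a r; last first.
  by apply/eqP; rewrite -leqn0 (leq_trans (e1 r)) // (leqNgt a r) ra.
have: e r != 0%N.
  by rewrite -e'E; apply: contraL rt => er; rewrite -leqNgt tmin // ar.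
have := e1 r; case: (e r) => [|[|?]] //; by case: (_ <= _ < _)%N.
Qed.

End Chi.

Arguments from1 : simpl never.

(** * The character of an interval representation *)
Section Formula.
Variables (k : closedFieldType) (n : nat).
Local Notation Q := (linear_quiver n).
Local Notation interval_rep := (interval_rep k n).

Lemma sum_arrows (F : 'I_n -> 'I_n -> int) :
  \sum_(a : arrow Q) F (src a) (tgt a) =
  \sum_(r : 'I_n) \sum_(s : 'I_n | (r : nat) == s.+1) F r s.
Proof.
rewrite pair_big_dep /=.
rewrite -(big_sub_cond [pred p : 'I_n * 'I_n | (p.1 : nat) == p.2.+1] predT
  (fun p => F p.1 p.2)) /=.
by apply: eq_bigl => p; rewrite inE andbT.
Qed.

Let alpha (r : 'I_n) : 'I_n -> int := fun i => (nat_of_bool (i == r))%:Z.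

(** The only arrow ending at [r] starts at [r+1]; when [r] is the last vertex there
    is none, and [E (r+1)] is 0. *)
Lemma euler_form_simple_r (E : nat -> nat) (r : 'I_n) :
  (forall s, (n <= s)%N -> E s = 0%N) ->
  euler_form Q (fun i => (E i)%:Z) (alpha r) = (E r)%:Z - (E r.+1)%:Z.
Proof.
move=> E0; rewrite /euler_form (bigD1 r) //= {1}/alpha eqxx mulr1 big1 ?addr0; last first.
  by move=> i ir; rewrite /alpha (negPf ir) mulr0.
congr (_ - _); rewrite (sum_arrows (fun s t => (E s)%:Z * alpha r t)).
have [rn|nr] := ltnP r.+1 n.
  rewrite (bigD1 (Ordinal rn)) //= (bigD1 r) //= /alpha eqxx mulr1.
  rewrite big1 ?addr0 => [|s /andP[_ /negPf->]]; last by rewrite mulr0.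
  rewrite big1 ?addr0 // => s sr; rewrite big1 // => t /eqP st.
  case: eqP => [tr|_]; last by rewrite mulr0.
  by rewrite -val_eqE /= st tr eqxx in sr.
rewrite E0 // big1 // => s _; rewrite big1 // => t /eqP st.
rewrite /alpha; case: eqP => [tr|_]; last by rewrite mulr0.
by have := ltn_ord s; rewrite st tr ltnNge nr.
Qed.

Lemma euler_form_simple_l (E : nat -> nat) (r : 'I_n) :
  euler_form Q (alpha r) (fun i => (E i)%:Z) =
    (E r)%:Z - (if (r : nat) is s.+1 then (E s)%:Z else 0).
Proof.
rewrite /euler_form (bigD1 r) //= {1}/alpha eqxx mul1r big1 ?addr0; last first.
  by move=> i ir; rewrite /alpha (negPf ir) mul0r.
congr (_ - _); rewrite (sum_arrows (fun s t => alpha r s * (E t)%:Z)).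
rewrite (bigD1 r) //= [X in _ + X]big1 ?addr0; last first.
  by move=> s /negPf sr; rewrite big1 // => t _; rewrite /alpha sr mul0r.
rewrite /alpha eqxx; case E1 : (r : nat) => [|u]; first by rewrite big1.
have un : (u < n)%N by apply: ltnW; rewrite -E1.
rewrite (bigD1 (Ordinal un)) //= mul1r big1 ?addr0 // => t.
rewrite eqSS => /andP[/eqP ut]; rewrite -val_eqE /= ut eqxx //.
Qed.

Lemma sum_offset (V : nmodType) (F : nat -> V) a m : (a <= m)%N ->
  \sum_(a <= t < m.+1) F t = \sum_(d < (m - a).+1) F (a + d)%N.
Proof.
move=> am; rewrite -{1}[a]add0n big_addn subSn // big_mkord.
by apply: eq_bigr => d _; rewrite addnC.
Qed.

Lemma prod_interval (R : comPzRingType) (v : nat -> R) a b N : (b <= N)%N ->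
  \prod_(r < N) v r ^+ (a <= r < b)%N = \prod_(a <= r < b) v r.
Proof.
move=> bN; rewrite (big_nat_widen a b N) // (big_nat_widenl a 0) // big_mkord.
rewrite [RHS]big_mkcond; apply: eq_bigr => r _ /=.
by rewrite andbC; case: (_ && _).
Qed.

Lemma from1_vertex (v : 'I_n -> ratfun n) (r : 'I_n) : from1 v r.+1 = v r.
Proof. by rewrite /from1 valK. Qed.

Lemma from1_big (v : 'I_n -> ratfun n) : from1 v n.+1 = 1.
Proof. by rewrite /from1 insubF ?ltnn. Qed.

Lemma monom_interval_dim (v : 'I_n -> ratfun n) a t : (t <= n)%N ->
  monom v (interval_dim a t) = \prod_(a <= s < t) from1 v s.+1.
Proof.
move=> tn; rewrite -(prod_interval (fun s => from1 v s.+1) a tn).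
by apply: eq_bigr => r _; rewrite from1_vertex.
Qed.

Local Notation x := (from1 (@xvar n)).
Local Notation y := (from1 (@yvar n)).
Local Notation z := (from1 (@zvar n)).

Lemma from1_x_neq0 i : x i != 0.
Proof.
case: i => [|i]; first exact: oner_neq0.
rewrite /from1; case: insub => [r|] /=; last exact: oner_neq0.
rewrite /xvar tofrac_eq0; apply/eqP => /(congr1 (mcoeff U_(lshift n (lshift n r)))).
by rewrite mcoeffX eqxx mcoeff0 => /eqP; rewrite oner_eq0.
Qed.

(** With [e = dim I(a, t)] and [d - e = dim I(t, m)] the exponent of the variable at
    the vertex [r] is [e (r+1) + (d - e) (r-1) - d r].  The first two terms are the
    indicators of the intervals shifted by one, [a-1, t-1) and [t+1, m+1), and
    [x_0 = x_(n+1) = 1] accounts for the shifts that leave the vertex set. *)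
Lemma X_summand_interval a t m : (a <= t <= m)%N -> (m <= n)%N ->
  \prod_(r : 'I_n)
    (xvar r ^ (- euler_form Q (fun i => (interval_dim a t i)%:Z) (alpha r)
               - euler_form Q (alpha r)
                   (fun i => (rdim (interval_rep a m) i)%:Z - (interval_dim a t i)%:Z)) *
     yvar r ^+ interval_dim a t r
     * zvar r ^+ (rdim (interval_rep a m) r - interval_dim a t r))
  = x a * x m.+1 / (x t * x t.+1)
    * (\prod_(a <= s < t) y s.+1 * \prod_(t <= s < m) z s.+1).
Proof.
move=> /andP[at_ tm] mn.
pose I b c (s : nat) : nat := (b <= s < c)%N.
have split s : (I a m s = I a t s + I t m s)%N.
  rewrite /I; have [ts|st] := leqP t s; first by rewrite (leq_trans at_ ts).
  by rewrite (leq_trans st tm) addn0.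
transitivity (\prod_(r < n) (x r.+1 ^+ I a.-1 t.-1 r * x r.+1 ^+ I t.+1 m.+1 r
   / x r.+1 ^+ I a m r * (y r.+1 ^+ I a t r * z r.+1 ^+ I t m r))).
  apply: eq_bigr => r _; rewrite -mulrA !from1_vertex.
  have -> : (rdim (interval_rep a m) r - interval_dim a t r = I t m r)%N.
    by rewrite /= -/(I a m r) split addKn.
  congr (_ * _).
  have -> : euler_form Q (fun i => (interval_dim a t i)%:Z) (alpha r)
      = (I a t r)%:Z - (I a t r.+1)%:Z.
    apply: (euler_form_simple_r (E := I a t)) => s ns.
    by rewrite /I [(s < t)%N]ltnNge (leq_trans tm (leq_trans mn ns)) andbF.
  have -> : euler_form Q (alpha r)
        (fun i => (rdim (interval_rep a m) i)%:Z - (interval_dim a t i)%:Z)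
      = (I t m r)%:Z - (I t.+1 m.+1 r)%:Z.
    transitivity (euler_form Q (alpha r) (fun i => (I t m i)%:Z)).
      rewrite /euler_form; congr (_ - _); apply: eq_bigr => i _; congr (_ * _);
      by rewrite /= -/(I a m _) split PoszD -/(I a t _) addrC addKr.
    rewrite euler_form_simple_l; congr (_ - _); rewrite /I.
    by case: (r : nat) => [|s].
  have -> : I a t r.+1 = I a.-1 t.-1 r.
    by rewrite /I; case: (a) (t) at_ => [|a'] [|t'].
  have xr0 : xvar r != 0 by rewrite -from1_vertex from1_x_neq0.
  rewrite split.
  have -> : - ((I a t r)%:Z - (I a.-1 t.-1 r)%:Z) - ((I t m r)%:Z - (I t.+1 m.+1 r)%:Z)
     = (I a.-1 t.-1 r)%:Z + (I t.+1 m.+1 r)%:Z - (I a t r + I t m r)%:Z.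
    by rewrite PoszD; ring.
  by rewrite !expfzDr // -exprnN -!exprnP.
rewrite !big_split /= prodfV.
rewrite (prod_interval (fun s => y s.+1)) ?(leq_trans tm) //.
rewrite (prod_interval (fun s => z s.+1) t mn) (prod_interval (fun s => x s.+1) a mn).
congr (_ * _); rewrite -(telescope_quotient from1_x_neq0) ?at_ ?tm //.
congr (_ * _ / _).
  rewrite (prod_interval (fun s => x s.+1)); last first.
    by apply: leq_trans (leq_pred t) (leq_trans tm mn).
  case: (a) (t) at_ => [|a'] [|t'] //= _.
  - by rewrite !big_geq.
  - by rewrite big_nat_recl //= mul1r.
  - by rewrite big_add1.
have := prod_interval (fun s => x s.+1) t.+1 (mn : (m.+1 <= n.+1)%N).
by rewrite big_ord_recr /= from1_big expr1n mulr1 big_add1.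
Qed.

End Formula.

Section Character.
Variables (k : closedFieldType) (n : nat).
Variables (chi : kspace k -> int) (Hchi : euler_characteristic chi).
Local Notation Q := (linear_quiver n).
Local Notation interval_rep := (interval_rep k n).
Local Notation x := (from1 (@xvar n)).
Local Notation y := (from1 (@yvar n)).
Local Notation z := (from1 (@zvar n)).

Lemma chi_gr_interval a m e :
  gr_point (interval_rep a m) e -> chi (quiver_grassmannian (interval_rep a m) e) = 1.
Proof.
move=> pt; apply: (@chi_point _ chi Hchi (quiver_grassmannian (interval_rep a m) e)) => //.
  2: exact: gr_interval_eq.
exact: discrete_quotient (@gr_interval_eq _ _ _ _ _).
Qed.

Lemma gr_point_ext (V : rep k Q) e e' : e =1 e' -> gr_point V e -> gr_point V e'.
Proof.
move=> ee [U /andP[sU /forallP rU]]; exists U; rewrite sU.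
by apply/forallP=> i; rewrite -ee.
Qed.

(** Only the dimension vectors [E d] of [I(a, a+d)] have a nonempty Grassmannian. *)
Lemma X_formula_interval a m : (a <= m <= n)%N ->
  X_formula chi (interval_rep a m) = interval_char x y z a m.
Proof.
case/andP=> am mn; rewrite /X_formula.
pose E (d : 'I_(m - a).+1) : {dffun forall i : 'I_n, 'I_(rdim (interval_rep a m) i).+1} :=
  [ffun i => inord (interval_dim a (a + d) i)].
have dm (d : 'I_(m - a).+1) : (a <= a + d <= m)%N.
  by rewrite leq_addr /= -leq_subRL // -ltnS.
have EE d i : E d i = interval_dim a (a + d) i :> nat.
  rewrite ffunE inordK // ltnS /interval_dim /=.
  have := dm d; case/andP=> _ tm.
  have [/andP[-> im]|//] := boolP (a <= i < a + d)%N; by rewrite (leq_trans im).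
have Einj : {in [pred d : 'I_(m - a).+1 | true] &, injective E}.
  suff lt (d d' : 'I_(m - a).+1) : (d < d')%N -> E d != E d'.
    move=> d d' _ _ EE'; apply: val_inj => /=; apply/eqP.
    by case: ltngtP => // /lt; rewrite EE' eqxx.
  move=> dd'; have vn : (a + d < n)%N.
    by have /andP[_ h] := dm d'; apply: leq_trans (leq_trans h mn); rewrite ltn_add2l.
  apply/eqP=> Edd; have := EE d (Ordinal vn); rewrite Edd EE /interval_dim /=.
  by rewrite ltnn andbF leq_addr ltn_add2l dd'.
rewrite (bigID (mem [set E d | d in [pred d | true]])) /= [X in _ + X]big1 ?addr0; last first.
  move=> e eE; rewrite (chi_empty Hchi) ?mul0r //.
    exact: discrete_quotient (@gr_interval_eq _ _ _ _ _).
  move=> pt; have [t /andP[at_ tm] et] := gr_interval_dim mn am pt.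
  case/imsetP: eE; have dP : (t - a < (m - a).+1)%N by rewrite ltnS leq_sub2r.
  exists (Ordinal dP) => //; apply/ffunP => i; apply: val_inj => /=.
  by rewrite EE /= subnKC // -et.
rewrite big_imset //= /interval_char big_distrr /= sum_offset //.
apply: eq_bigr => d _.
rewrite chi_gr_interval ?mul1r; last first.
  apply: (gr_point_ext (e := interval_dim a (a + d))) => [i|]; first by rewrite EE.
  by apply: gr_interval_point; case/andP: (dm d).
rewrite [RHS]mulrA [RHS]mulrAC -(X_summand_interval k (dm d) mn).
apply: eq_bigr => r _; rewrite EE; congr (xvar r ^ (- _ - _) * _ * _).
  by rewrite /euler_form; congr (_ - _); apply: eq_bigr => i _; rewrite EE.
by rewrite /euler_form; congr (_ - _); apply: eq_bigr => i _; rewrite EE.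
Qed.

End Character.

(** * The objects of the cluster category *)
Section Objects.
Variables (k : closedFieldType) (n : nat).
Local Notation Q := (linear_quiver n).
Local Notation interval_rep := (interval_rep k n).

(** The inverse translate is given by an almost split sequence here, as [I(a, m)] is
    neither injective nor a shifted projective when [m < n]. *)
Lemma tau_inv_interval a m (A B : cobj k Q) : (a < m < n)%N ->
  ciso A (cmodule (interval_rep a m)) -> tau_inv A B ->
  ciso B (cmodule (interval_rep a.+1 m.+1)).
Proof.
move=> amn [isoA sA] [M N MN [AM _] [BN sB]|j [I inj [AI _]] _|j [_ sj] _].
- split; last exact: sB.
  apply: rep_iso_trans BN (almost_split_interval amn MN _).
  exact: rep_iso_trans (rep_iso_sym AM) isoA.
- have [] := interval_not_injective amn (rep_iso_trans (rep_iso_sym AI) isoA) inj.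
- by have := sj j; rewrite sA /= eqxx.
Qed.

Variable O : nat -> nat -> cobj k Q.
Hypothesis O_proj : forall j : 'I_n, is_P j (O 0%N j.+1).
Hypothesis O_tau : forall i j : nat, (1 <= j)%N -> (i.+1 + j <= n)%N ->
       tau_inv (O i j) (O i.+1 j).

Lemma object_interval i j : (1 <= j)%N -> (i + j <= n)%N ->
  ciso (O i j) (cmodule (interval_rep i (i + j))).
Proof.
move=> j1; elim: i => [|i IH] ijn.
  case: j j1 ijn => // j _ jn; have [P projP [isoP sP]] := O_proj (Ordinal jn).
  by split=> //; exact: rep_iso_trans isoP (projective_interval projP).
rewrite addSn; apply: (tau_inv_interval _ (IH (ltnW ijn)) (O_tau j1 ijn)).
by rewrite ijn andbT -{1}[i]addn0 ltn_add2l.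
Qed.

End Objects.

Theorem corollary3p3 (k : closedFieldType) (n : nat)
    (chi : kspace k -> int) (Hchi : euler_characteristic chi)
    (X : cobj k (linear_quiver n) -> ratfun n)
    (HX : cluster_character chi X)
    (O : nat -> nat -> cobj k (linear_quiver n))
    (O_zero : forall i, ciso (O i 0%N) (czero k (linear_quiver n)))
    (O_proj : forall j : 'I_n, is_P j (O 0%N j.+1))
    (O_tau : forall i j : nat, (1 <= j)%N -> (i.+1 + j <= n)%N ->
       tau_inv (O i j) (O i.+1 j)) :
  let x := from1 (@xvar n) in
  let y := from1 (@yvar n) in
  let z := from1 (@zvar n) in
  [/\ forall j : nat, (1 <= j <= n)%N ->
        x j * X (O j.-1 1%N) = x j.-1 * y j + x j.+1 * z j,
      forall j a b : nat, (1 <= a)%N -> (j + a <= b)%N -> (b <= n)%N ->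
        X (O j (b - j)%N) * x (j + a)%N =
          X (O (j + a)%N (b - j - a)%N) * x j * monom (@yvar n) (cdim (O j a))
          + X (O j a.-1) * x b.+1
            * monom (@zvar n) (cdim (O (j + a).-1 (b - j - a).+1))
    & forall j : nat, (1 <= j <= n)%N ->
        (\prod_(1 <= r < j) z r) * x j =
        \det (\matrix_(r < j, c < j)
          (if c == r :> nat then (if r == 0%N :> nat then x 1%N else X (O r.-1 1%N))
           else if c == r.+1 :> nat then y c
           else if r == c.+1 :> nat then (if c == 0%N :> nat then 1 else z c)
           else 0))].
Proof.
move=> x y z.
pose G := interval_char x y z.
have X_G i m : (i <= m <= n)%N -> X (O i (m - i)%N) = G i m.
  case/andP=> im mn; have x0 := @from1_x_neq0 n.
  move: im; rewrite leq_eqVlt => /predU1P[->|im].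
    by rewrite subnn (cc_iso HX (O_zero m)) (cc_zero HX) /G interval_char_nil.
  have mi : (1 <= m - i)%N by rewrite subn_gt0.
  have E : (i + (m - i) = m)%N by rewrite subnKC // ltnW.
  have := object_interval O_proj O_tau mi (i := i); rewrite E => /(_ mn) /(cc_iso HX) ->.
  rewrite (cc_module HX) ?(X_formula_interval Hchi) ?(ltnW im) //.
  by apply: interval_indecomposable; rewrite im.
have simpleE j : (j < n)%N -> x j.+1 * X (O j 1%N) = x j * y j.+1 + x j.+2 * z j.+1.
  move=> jn; have := X_G j j.+1; rewrite subSnn => -> //.
    by apply: interval_char_simple; exact: from1_x_neq0.
  by rewrite leqnSn.
have dimE i j : (1 <= j)%N -> (i + j <= n)%N -> cdim (O i j) =1 interval_dim i (i + j).
  by move=> j1 ijn; have [/rep_iso_dim] := object_interval O_proj O_tau j1 ijn.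
have monomE v i m : (i < m <= n)%N ->
    monom v (cdim (O i (m - i)%N)) = \prod_(i <= s < m) from1 v s.+1.
  case/andP=> im mn; rewrite -monom_interval_dim //.
  by apply: eq_bigr => r _; rewrite dimE ?subnKC ?subn_gt0 // ltnW.
split.
- by case=> // j /= jn; exact: simpleE.
- move=> j [//|c] b _ jb bn; rewrite !addnS /= in jb *.
  have -> : (b - j - c.+1 = b - (j + c).+1)%N by rewrite -subnDA addnS.
  have E1 : (j + c - j = c)%N by rewrite addKn.
  have -> : (b - (j + c).+1).+1 = (b - (j + c))%N by rewrite subnSK.
  have := monomE (@yvar n) j (j + c).+1; rewrite subSn ?leq_addr // E1 => ->; last first.
    by rewrite (leq_trans jb).
  rewrite (monomE (@zvar n)) ?jb //.
  have := X_G j (j + c)%N; rewrite E1 => ->; last first.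
    by rewrite leq_addr ltnW // (leq_trans jb).
  have jb' : (j <= b)%N by apply: leq_trans jb; rewrite leqW ?leq_addr.
  rewrite (X_G j b) ?jb' // (X_G (j + c).+1 b) ?jb //.
  by apply: interval_char_exchange; rewrite leq_addr.
- by case=> // j jn; rewrite -(det_exchange (y := y) (X := fun i => X (O i 1%N)) (n := n)).
Qed.
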